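(* Let $\pi\in\mathscr P_\Lambda$ be such that, for all $\mathbf Y'\in\mathbb R^n$ and all $\beta>0$, the mappings $\lambda\mapsto\theta_\lambda(\mathbf Y')f_\lambda^2(x_i)$, $i=1,\dots,n$, are $\pi$-integrable (here $\theta_\lambda(\mathbf Y')=\theta_\lambda(\beta,\pi,\mathbf Y')$). Assume that $E(\xi_1^2)=\sigma^2<\infty$ and that there exists a function $g_\xi:\mathbb R\to\mathbb R_+$ with $\|g_\xi\|_\infty:=\sup_{x\in\mathbb R}g_\xi(x)<\infty$ such that $$\int_a^{a'}m_\xi(z)\,dz=\int_a^{a'}g_\xi(z)\,dF_\xi(z)\qquad\text{for all }a,a'\in\mathbb R,$$ i.e. the measure $m_\xi(z)\,dz$ is absolutely continuous with respect to $dF_\xi(z)$ with bounded Radon–Nikodym derivative $g_\xi$. Then, for every $\beta>0$ with $\beta\ge 4\|g_\xi\|_\infty$, the aggregate $\hat f_n$ satisfies $$E\big(\|\hat f_n-f\|_n^2\big)\le\int_\Lambda\|f_\lambda-f\|_n^2\,p(d\lambda)+\frac{\beta\,\mathcal K(p,\pi)}{n}\qquad\text{for all }p\in\mathscr P_\Lambda.$$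
   Context: Model: $Y_i=f(x_i)+\xi_i$, $i=1,\dots,n$, where $x_1,\dots,x_n$ are non-random elements of a set $\mathcal X$, $f:\mathcal X\to\mathbb R$ is an unknown function, and $\xi_1,\dots,\xi_n$ are i.i.d. zero-mean real random variables with c.d.f. $F_\xi(z)=P(\xi_1\le z)$. Write $\mathbf Y=(Y_1,\dots,Y_n)$. Define $m_\xi(x)=-E[\xi_1\mathbf 1(\xi_1\le x)]=-\int_{-\infty}^x z\,dF_\xi(z)=\int_x^\infty z\,dF_\xi(z)$. $(\Lambda,\mathcal A)$ is a measurable space, $\mathscr P_\Lambda$ is the set of all probability measures on it, and $\{f_\lambda,\lambda\in\Lambda\}$ is a given family of (non-random) functions $f_\lambda:\mathcal X\to\mathbb R$ such that $\lambda\mapsto f_\lambda(x)$ is measurable for every $x\in\mathcal X$. Norms: for functions $g,h$ on $\mathcal X$, $\|g-h\|_n^2=\frac1n\sum_{i=1}^n(g(x_i)-h(x_i))^2$; for a vector $\mathbf y\in\mathbb R^n$, $\|\mathbf y-f_\lambda\|_n^2=\frac1n\sum_{i=1}^n(y_i-f_\lambda(x_i))^2$. For a prior $\pi\in\mathscr P_\Lambda$ and $\beta>0$, the exponentially weighted aggregate is $$\hat f_n(x)=\int_\Lambda\theta_\lambda(\mathbf Y)f_\lambda(x)\,\pi(d\lambda),\qquad \theta_\lambda(\mathbf y)=\frac{\exp\{-n\|\mathbf y-f_\lambda\|_n^2/\beta\}}{\int_\Lambda\exp\{-n\|\mathbf y-f_w\|_n^2/\beta\}\,\pi(dw)}.$$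 $\mathcal K(p,\pi)$ is the Kullback–Leibler divergence, $\mathcal K(p,\pi)=\int\log\frac{dp}{d\pi}\,dp$ if $p\ll\pi$ and $+\infty$ otherwise. *)

(* Defs.v *)
From HB Require Import structures.
From mathcomp Require Import all_boot all_order all_algebra.
From mathcomp Require Import all_classical all_reals all_analysis.
Set Implicit Arguments.
Unset Strict Implicit.
Unset Printing Implicit Defensive.
Import Order.TTheory GRing.Theory Num.Theory.
Import numFieldNormedType.Exports.
Local Open Scope classical_set_scope.
Local Open Scope ring_scope.
Local Open Scope charge_scope.
Local Open Scope ereal_scope.

Section random_variables.
Context d (Omega : measurableType d) (R : realType) (P : probability Omega R).

Definition mutually_independent (I : finType) (X : I -> {RV P >-> R}) : Prop :=
  forall (J : {set I}) (A : I -> set R), (forall i, measurable (A i)) ->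
    P (\bigcap_(i in [set` J]) X i @^-1` A i) =
    \prod_(i in J) P (X i @^-1` A i).

(* Equality is only required on measurable sets: the values of [distribution]
   elsewhere carry no meaning. *)
Definition identically_distributed (I : Type) (X : I -> {RV P >-> R}) : Prop :=
  forall i j (A : set R), measurable A ->
    distribution P (X i) A = distribution P (X j) A.

Definition iid (I : finType) (X : I -> {RV P >-> R}) : Prop :=
  mutually_independent X /\ identically_distributed X.

(* The expectation is finite, hence [fine] harmless, whenever X is integrable. *)
Definition m_fun (X : {RV P >-> R}) (x : R) : R :=
  (- fine 'E_P[fun w => X w * \1_[set u | X u <= x] w])%R.

End random_variables.

(* [J A] stands for the integral over A of some function for some measure on the
   line; the result is the integral "from a to b" of calculus, also meaningful
   for b < a. The half-open interval is the Stieltjes convention for measures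
   with atoms, so that integrals over adjacent intervals add up. *)
Definition oriented (R : realType) (J : set R -> \bar R) (a b : R) : \bar R :=
  if (a <= b)%R then J `]a, b]%classic else - J `]b, a]%classic.

(* [+oo] without absolute continuity. Otherwise [lne] takes the value [-oo]
   where the Radon-Nikodym derivative is nonpositive, a p-null set. *)
Definition KL d (T : measurableType d) (R : realType)
    (p q : probability T R) : \bar R :=
  if `[< p `<< q >]
  then \int[p]_t lne ('d (charge_of_finite_measure p) '/d q t)
  else +oo.

Local Close Scope ereal_scope.

Section aggregation.
Context (R : realType) (X : Type) (n : nat) (x : 'I_n -> X).

(* Squared empirical norms [|| g - h ||_n^2] and [|| y - h ||_n^2]. *)
Definition sqdist_fun (g h : X -> R) : R :=
  n%:R^-1 * \sum_(i < n) (g (x i) - h (x i)) ^+ 2.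

Definition sqdist_vec (y : 'rV[R]_n) (h : X -> R) : R :=
  n%:R^-1 * \sum_(i < n) (y 0 i - h (x i)) ^+ 2.

Definition observations d (Omega : measurableType d) (P : probability Omega R)
    (f : X -> R) (xi : 'I_n -> {RV P >-> R}) (w : Omega) : 'rV[R]_n :=
  \row_i (f (x i) + xi i w).

Context d (Lambda : measurableType d) (fam : Lambda -> X -> R).

Definition theta (beta : R) (prior : probability Lambda R) (y : 'rV[R]_n)
    (l : Lambda) : R :=
  expR (- (n%:R * sqdist_vec y (fam l)) / beta) /
  \int[prior]_w expR (- (n%:R * sqdist_vec y (fam w)) / beta).

Definition aggregate (beta : R) (prior : probability Lambda R) (y : 'rV[R]_n)
    (t : X) : R :=
  \int[prior]_l (theta beta prior y l * fam l t).

End aggregation.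

(* Main.v *)
Require Import Defs.
From HB Require Import structures.
From mathcomp Require Import all_boot all_order all_algebra.
From mathcomp Require Import all_classical all_reals all_analysis.
From mathcomp Require Import measurable_realfun.
From mathcomp Require Import ring lra.
Set Implicit Arguments.
Unset Strict Implicit.
Unset Printing Implicit Defensive.
Import Order.TTheory GRing.Theory Num.Theory.
Import numFieldNormedType.Exports.
Local Open Scope classical_set_scope.
Local Open Scope ring_scope.

(* Write m_i for the aggregate at x_i and V_i for the variance of f_lambda(x_i)
   under the posterior theta_lambda(Y) pi(d lambda).  Pointwise in the noise,
   the Gibbs variational principle applied to n ||Y - f_lambda||_n^2 / beta gives
     sum_i ((Y_i - m_i)^2 + V_i) <= n int ||Y - f_lambda||_n^2 dp + beta K(p, pi).
   Expanding Y = f + xi, the squares xi_i^2 cancel and, with c_i the mean of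
   f_lambda(x_i) under p,
     sum_i (m_i - f(x_i))^2 + sum_i V_i
       <= n int ||f_lambda - f||_n^2 dp + beta K(p, pi) + 2 sum_i xi_i (m_i - c_i).
   It remains to see that E[xi_i (m_i - c_i)] <= E[V_i] / 2.  As a function of
   Y_i, m_i is the mean of an exponential family, so its derivative is
   2 V_i / beta >= 0.  Conditionally on the other coordinates, Stein's identity
   E[xi (phi(xi) - phi(0))] = int phi' m_xi = E[phi'(xi) g_xi(xi)] for
   nondecreasing phi is Tonelli's theorem, so it needs no integrability, and
   2 g_xi / beta <= 1 / 2.  The first inequality also supplies all the
   integrability needed to take expectations. *)

(** * Measures with a density *)

Section density.
Local Open Scope ereal_scope.
Context d (T : measurableType d) (R : realType).
Import HBNNSimple.

(** Monotone approximation by simple functions reduces the claim to the formula for [nu] on level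
    sets. [nu] is any measure with these values, so the lemma serves both a Radon-Nikodym derivative
    and the measure [density] below. *)
Lemma ge0_integral_density (mu nu : {measure set T -> \bar R}) (r : T -> R) :
  measurable_fun setT r -> (forall x, (0 <= r x)%R) ->
  (forall A, measurable A -> nu A = \int[mu]_(x in A) (r x)%:E) ->
  forall h : T -> \bar R, measurable_fun setT h -> (forall x, 0 <= h x) ->
  \int[nu]_x h x = \int[mu]_x (h x * (r x)%:E).
Proof.
move=> mr r0 nuE f mf f0.
have mr' : measurable_fun setT (fun x => (r x)%:E) by exact/measurable_EFinP.
pose h := nnsfun_approx measurableT mf.
have -> : \int[nu]_x f x = limn (fun n => \int[nu]_x (h n x)%:E).
  rewrite -monotone_convergence//.
  - apply: eq_integral => x _; apply/esym/cvg_lim => //.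
    by apply: cvg_nnsfun_approx => // *.
  - by move=> n; exact/measurable_EFinP.
  - by move=> n x _; rewrite lee_fin.
  - by move=> x _ a b ab; rewrite lee_fin; exact/lefP/nd_nnsfun_approx.
have -> : \int[mu]_x (f x * (r x)%:E) =
    limn (fun n => \int[mu]_x ((h n x)%:E * (r x)%:E)).
  rewrite -monotone_convergence//.
  - apply: eq_integral => x _; apply/esym/cvg_lim => //.
    by apply: cvgeZr => //; apply: cvg_nnsfun_approx => // *.
  - by move=> n; apply: emeasurable_funM => //; exact/measurable_EFinP.
  - by move=> n x _; rewrite mule_ge0 ?lee_fin.
  - move=> x _ a b ab; rewrite lee_wpmul2r ?lee_fin//.
    exact/lefP/nd_nnsfun_approx.
have ind_ge0 n k x : 0 <= (k * \1_(h n @^-1` [set k]) x)%:E.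
  by rewrite EFinM nnfun_muleindic_ge0.
suff suf n : \int[nu]_x (h n x)%:E = \int[mu]_x ((h n x)%:E * (r x)%:E).
  by under eq_fun do rewrite suf.
transitivity (\sum_(k \in range (h n))
    \int[nu]_x (k * \1_(h n @^-1` [set k]) x)%:E).
  under eq_integral do rewrite fimfunE -fsumEFin//.
  rewrite ge0_integral_fsum//.
  - by move=> y; exact/measurable_EFinP/measurable_funM.
  - by move=> y x _; exact: ind_ge0.
transitivity (\sum_(k \in range (h n))
    \int[mu]_x ((k * \1_(h n @^-1` [set k]) x)%:E * (r x)%:E)); last first.
  rewrite -ge0_integral_fsum//.
  - apply: eq_integral => x _; rewrite -ge0_mule_fsuml => [|y].
      by rewrite fsumEFin// -(fimfunE _ x).
    exact: ind_ge0.
  - move=> y; apply: emeasurable_funM => //.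
    by exact/measurable_EFinP/measurable_funM.
  - by move=> y x _; apply: mule_ge0; [exact: ind_ge0|rewrite lee_fin].
apply: eq_fsbigr => k khn.
rewrite integralZl_indic_nnsfun// integral_indic// setIT.
under [RHS]eq_integral do rewrite EFinM -muleA.
rewrite ge0_integralZl//.
- under eq_integral do rewrite muleC.
  rewrite [X in _ = _ * X](eq_integral
    ((fun x => (r x)%:E) \_ (h n @^-1` [set k]))); last first.
    by move=> x _; rewrite epatch_indic.
  by rewrite -integral_mkcond nuE.
- by apply: emeasurable_funM => //; exact/measurable_EFinP.
- by move=> x _; rewrite mule_ge0 ?lee_fin.
- by move: khn; rewrite inE => -[t _ <-]; rewrite lee_fin.
Qed.

(* The proofs are arguments so that the measure structure can be inferred. *)
Definition density (mu : {measure set T -> \bar R}) (r : T -> R)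
    (mr : measurable_fun setT r) (r0 : forall x, (0 <= r x)%R) (A : set T) :=
  \int[mu]_(x in A) (r x)%:E.

Section measure.
Variables (mu : {measure set T -> \bar R}) (r : T -> R).
Hypotheses (mr : measurable_fun setT r) (r0 : forall x, (0 <= r x)%R).

Let density0 : density mu mr r0 set0 = 0.
Proof. by rewrite /density integral_set0. Qed.

Let density_ge0 A : 0 <= density mu mr r0 A.
Proof. by apply: integral_ge0 => x _; rewrite lee_fin. Qed.

Let density_sigma_additive : semi_sigma_additive (density mu mr r0).
Proof.
move=> F mF tF mUF; rewrite /density ge0_integral_bigcup//.
- apply: is_cvg_ereal_nneg_natsum_cond => n _ _.
  by apply: integral_ge0 => x _; rewrite lee_fin.
- by apply: measurable_funTS; exact/measurable_EFinP.
- by move=> x _; rewrite lee_fin.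
Qed.

HB.instance Definition _ := isMeasure.Build _ _ _ (density mu mr r0)
  density0 density_ge0 density_sigma_additive.

End measure.

End density.

(** * The Gibbs variational principle *)

Lemma measurable_funV d (T : measurableType d) (R : realType) (f : T -> R) :
  measurable_fun setT f -> measurable_fun setT (fun t => (f t)^-1).
Proof.
move=> mf; rewrite (_ : (fun t => _) = fun t => f t * (f t ^+ 2) `^ (-1)).
  (* x^-1 = x * (x^2)^-1, and at 0 both sides take the value 0. *)
  apply: measurable_funM => //.
  apply: (measurableT_comp (measurable_powR _)); exact: measurable_funX.
apply/funext => t; rewrite powRN powRr1 ?sqr_ge0//.
have [->|ft0] := eqVneq (f t) 0; first by rewrite mul0r invr0.
by rewrite expr2 invfM mulrA mulfV// mul1r.
Qed.

Section gibbs.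
Context d (T : measurableType d) (R : realType).
Implicit Types p q : probability T R.

(** The tangent bound [ln v <= v - 1] at [v = u^-1]. It stands in for Jensen's inequality in the
    variational principle. *)
Lemma ln_ge1Bv (u : R) : 0 < u -> 1 - u^-1 <= ln u.
Proof.
move=> u0; have := @le_ln1Dx R (u^-1 - 1).
rewrite addrCA subrr addr0 lnV// => /(_ _)/wrap[].
  by rewrite -subr_gt0 opprK subrK invr_gt0.
lra.
Qed.

(** * The partition function and the mean energy of a Gibbs measure *)

Section partition_function.
Variables (q : probability T R) (psi : T -> R).
Hypotheses (mpsi : measurable_fun setT psi) (psi0 : forall t, 0 <= psi t).

Local Notation B := (\int[q]_t expR (- psi t)).

Lemma measurable_expRN : measurable_fun setT (fun t => expR (- psi t)).
Proof. by apply: measurableT_comp => //; exact: measurable_funN. Qed.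

Lemma integrable_expRN : q.-integrable setT (fun t => (expR (- psi t))%:E).
Proof.
apply: measurable_bounded_integrable => //.
- by rewrite (le_lt_trans (probability_le1 _ _))// ltry.
- exact: measurable_expRN.
- exists 1; split => // x x1 t _ /=; rewrite ger0_norm ?expR_ge0//.
  by rewrite (le_trans _ (ltW x1))// -expR0 ler_expR oppr_le0.
Qed.

Lemma partition_gt0 : 0 < B.
Proof.
rewrite lt_neqAle Rintegral_ge0 ?andbT; last by move=> *; exact: expR_ge0.
apply/eqP => B0.
have : (\int[q]_t `|(expR (- psi t))%:E| = 0)%E.
  under eq_integral do rewrite gee0_abs ?lee_fin ?expR_ge0//.
  have /fineK <- := integrable_fin_num measurableT integrable_expRN.
  by rewrite -[fine _]/B -B0.
have mE : measurable_fun setT (fun t => (expR (- psi t))%:E).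
  by apply/measurable_EFinP; exact: measurable_expRN.
move=> /ae_eq_integral_abs => /(_ measurableT mE).
move=> [N [mN N0 /= sN]].
have : (q setT <= q N)%E.
  apply: le_measure; rewrite ?inE// => t _; apply: sN => /= /(_ I).
  by move=> [] /eqP; rewrite gt_eqF// expR_gt0.
by rewrite N0 [X in (X <= _)%E]probability_setT lee_fin ler10.
Qed.

Lemma partition_le1 : B <= 1.
Proof.
have -> : 1 = \int[q]_t (cst 1 t) :> R.
  rewrite Rintegral_cst//.
  rewrite mul1r.
  rewrite [X in fine X]probability_setT.
  by [].
apply: le_Rintegral => //.
- exact: integrable_expRN.
- exact: finite_measure_integrable_cst.
- by move=> t _; rewrite -expR0 ler_expR oppr_le0.
Qed.

(** The Gibbs measure, of density [expR (- psi) / B] with respect to [q], has divergence [- ln B]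
    minus its mean energy; the bound expresses that this divergence is nonnegative. *)
Lemma gibbs_energy_le :
  (\int[q]_t (expR (- psi t) / B * psi t)%:E <= (- ln B)%:E)%E.
Proof.
have B0 := partition_gt0.
(* Multiplying [1 - v^-1 <= ln v] by [v = expR (- psi t) / B] gives the affine bound [H] with this
   slope, and its integral is [1 - c * B = - ln B]. *)
pose c := (1 + ln B) / B.
have mE := measurable_expRN.
have H t : expR (- psi t) / B * psi t <= 1 - c * expR (- psi t).
  have := @ln_ge1Bv (expR (- psi t) / B).
  rewrite divr_gt0 ?expR_gt0// lnM ?posrE ?expR_gt0 ?invr_gt0// expRK lnV//.
  move=> /(_ isT); rewrite invfM invrK.
  set e := expR _ => h.
  have e0 : 0 < e / B by rewrite divr_gt0// expR_gt0.
  have := ler_wpM2l (ltW e0) h.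
  rewrite mulrBr mulr1 mulrA (_ : e / B * (e^-1) * B = 1); last first.
    by field; rewrite !gt_eqF// expR_gt0.
  by rewrite /c; nra.
apply: (@le_trans _ _ (\int[q]_t (1 - c * expR (- psi t))%:E)%E).
  apply: ge0_le_integral => //.
  - by move=> t _; rewrite lee_fin mulr_ge0// divr_ge0 ?expR_ge0// ltW.
  - apply/measurable_EFinP; apply: measurable_funM => //.
    exact: measurable_funM.
  - apply/measurable_EFinP; apply: measurable_funB => //.
    exact: measurable_funM.
  by move=> t _; rewrite lee_fin.
under eq_integral do rewrite EFinB EFinM.
rewrite integralB//.
- rewrite integralZl//; last exact: integrable_expRN.
  have /fineK <- := integrable_fin_num measurableT integrable_expRN.
  rewrite -[fine _]/B integral_cst// [X in (_ * X)%E]probability_setT mule1 -EFinM -EFinB.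
  by rewrite lee_fin /c divfK ?gt_eqF//; lra.
- exact: finite_measure_integrable_cst.
- by apply: integrableZl => //; exact: integrable_expRN.
Qed.

End partition_function.

(** * The free energy [- ln B] as a lower bound for energy plus divergence *)

Section variational.
Local Open Scope charge_scope.
Variables (p q : probability T R).
Hypothesis pq : p `<< q.
Let r t : R := fine ('d (charge_of_finite_measure p) '/d q t).
Let rE t : 'd (charge_of_finite_measure p) '/d q t = (r t)%:E.
Proof. by rewrite fineK// Radon_Nikodym_fin_num. Qed.
Let mr : measurable_fun setT r.
Proof.
apply/measurable_EFinP; rewrite (_ : _ \o _ = 'd (charge_of_finite_measure p) '/d q).
  exact: measurable_int (Radon_Nikodym_integrable _).
by apply/funext => t; rewrite rE.
Qed.
Let D := [set t | 0 < r t].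
Let mD : measurable D.
Proof. by rewrite -[D]setTI; apply: measurable_fun_ltr. Qed.
Let pE A : measurable A -> p A = (\int[q]_(t in A) (r t)%:E)%E.
Proof.
move=> mA; under eq_integral do rewrite -rE.
exact: (Radon_Nikodym_integral (nu:=charge_of_finite_measure p)).
Qed.
Let pND : p (~` D) = 0%E.
Proof.
apply/eqP; rewrite -measure_le0 [X in (X <= _)%E]pE; last exact: measurableC.
under eq_integral do rewrite -[r _]opprK EFinN.
rewrite integral_ge0N ?oppe_le0; last first.
  by move=> t /negP; rewrite -leNgt lee_fin oppr_ge0.
by apply: integral_ge0 => t /negP; rewrite -leNgt lee_fin oppr_ge0.
Qed.

(** The derivative is determined only up to null sets and may be negative somewhere. Its positive
    part is still a density of [p], because the complement of [D] is [p]-null, and it is nonnegative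
    everywhere, as [ge0_integral_density] requires. *)
Let rp t : R := Num.max 0 (r t).
Let mrp : measurable_fun setT rp.
Proof. exact: measurable_maxr. Qed.
Let rp0 t : 0 <= rp t. Proof. by rewrite /rp le_max lexx. Qed.
Let rpD t : D t -> rp t = r t.
Proof. by move=> Dt; rewrite /rp max_r// ltW. Qed.
Let rpND t : ~ D t -> rp t = 0.
Proof. by move=> /negP; rewrite -leNgt => Dt; rewrite /rp max_l. Qed.

Let prpE A : measurable A -> p A = (\int[q]_(t in A) (rp t)%:E)%E.
Proof.
move=> mA; have mAD : measurable (A `&` D) by exact: measurableI.
have mAND : measurable (A `&` ~` D) by apply: measurableI => //; exact: measurableC.
have AE : A = (A `&` D) `|` (A `&` ~` D) by rewrite -setIUr setUCr setIT.
have dis : (A `&` D) `&` (A `&` ~` D) = set0.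
  by rewrite seteqP; split => t // [[_ ?] [_ ?]].
transitivity (p (A `&` D)).
  rewrite {1}AE measureU//.
  rewrite [X in (_ + X)%E](_ : _ = 0%E) ?adde0//.
  by apply: (subset_measure0 _ _ _ pND) => //; exact: measurableC.
rewrite pE// [in RHS]AE ge0_integral_setU//; last 3 first.
- by rewrite -AE; apply/measurable_EFinP; exact: measurable_funTS.
- by move=> t _; rewrite lee_fin.
- by apply/disj_setPS; rewrite dis.
rewrite [X in (_ = _ + X)%E]integral0_eq ?adde0; last first.
  by move=> t [_ NDt]; rewrite rpND.
by apply: eq_integral => t /[!inE] -[_ Dt]; rewrite rpD.
Qed.

Let int_rp (h : T -> R) : measurable_fun setT h -> (forall t, 0 <= h t) ->
  (\int[p]_t (h t)%:E = \int[q]_t (h t * rp t)%:E)%E.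
Proof.
move=> mh h0; rewrite (ge0_integral_density mrp rp0 prpE)//.
by apply/measurable_EFinP.
Qed.

(** The integrands differ only off [D], where [lne] is [-oo] and [ln 0] is 0 by convention; that set
    is [p]-null. *)
Let KLE : KL p q = (\int[p]_t (ln (rp t))%:E)%E.
Proof.
rewrite /KL; case: asboolP => // _; apply: ae_eq_integral => //.
- under eq_fun do rewrite rE /=.
  apply: measurable_fun_ifT => //; first exact: measurable_fun_ler.
  by apply/measurable_EFinP; exact: measurableT_comp.
- by apply/measurable_EFinP; exact: measurableT_comp.
- exists (~` D); split => //; first exact: measurableC.
  by move=> t /= H Dt; apply: H => _; rewrite (rpD Dt) rE lne_EFin.
Qed.

Section potential.
Variable psi : T -> R.
Hypotheses (mpsi : measurable_fun setT psi) (psi0 : forall t, 0 <= psi t).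
Local Notation B := (\int[q]_t expR (- psi t)).

(* Outside D, a p-null set, the value [1 - ln B >= 0] makes [u_ge] below hold
   everywhere rather than almost everywhere. *)
Let u t := if 0 < r t then expR (- psi t) / (B * rp t) else 1 - ln B.

Let u_ge0 t : 0 <= u t.
Proof.
rewrite /u; case: ifP => _.
  rewrite divr_ge0 ?expR_ge0// mulr_ge0//; exact/ltW/partition_gt0.
rewrite subr_ge0 (@le_trans _ _ 0)// -ln1 ler_ln ?posrE//.
  exact: partition_le1.
exact: partition_gt0.
Qed.

Let mu_ : measurable_fun setT u.
Proof.
apply: measurable_fun_ifT => //; first exact: measurable_fun_ltr.
apply: measurable_funM; first exact: measurable_expRN.
by apply: measurable_funV; exact: measurable_funM.
Qed.

(** On [D], [u] is the density of the Gibbs measure with respect to [p]. The Gibbs measure may also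
    charge the complement of [D], hence an inequality. *)
Let int_u : (\int[p]_t (u t)%:E <= 1)%E.
Proof.
rewrite int_rp//.
apply: (@le_trans _ _ (\int[q]_t (B^-1 * expR (- psi t))%:E)%E).
  apply: ge0_le_integral => //.
  - by move=> t _; rewrite lee_fin mulr_ge0.
  - by apply/measurable_EFinP; apply: measurable_funM.
  - by apply/measurable_EFinP; apply: measurable_funM => //; exact: measurable_expRN.
  - move=> t _; rewrite lee_fin /u; case: ifPn => [r0|].
      rewrite invfM mulrA -mulrA mulVf ?mulr1 1?mulrC//.
      by rewrite rpD// gt_eqF.
    move=> /negP r0; rewrite rpND// mulr0 mulr_ge0 ?expR_ge0// invr_ge0.
    exact/ltW/partition_gt0.
under eq_integral do rewrite EFinM.
rewrite integralZl//; last exact: integrable_expRN.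
have /fineK <- := integrable_fin_num measurableT (integrable_expRN q mpsi psi0).
rewrite -[fine _]/B -EFinM mulVf// gt_eqF//; exact: partition_gt0.
Qed.

(** On [D] this is [ln_ge1Bv] at [rp t * expR (psi t) * B], whose inverse is [u t]. After
    integration against [p] the term [u t - 1] contributes a nonpositive amount, by [int_u]. *)
Let u_ge t : - ln B <= psi t + ln (rp t) + (u t - 1).
Proof.
have B0 := partition_gt0 q mpsi psi0.
rewrite /u; case: ifPn => [r0|/negP r0].
  have rp_gt0 : 0 < rp t by rewrite rpD.
  have := @ln_ge1Bv (rp t * expR (psi t) * B).
  rewrite !mulr_gt0 ?expR_gt0// !lnM ?posrE ?mulr_gt0 ?expR_gt0// expRK.
  move=> /(_ isT).
  rewrite expRN !invfM [X in 1 - X](_ : _ = (expR (psi t))^-1 * (B^-1 * (rp t)^-1)); last by ring.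
  lra.
have -> : ln (rp t) = 0 by rewrite rpND// ln0.
by have := psi0 t; move: (ln _) (psi t) => a b; lra.
Qed.

Let integrable_u : p.-integrable setT (EFin \o u).
Proof.
apply/integrableP; split; first exact/measurable_EFinP.
under eq_integral do rewrite /= ger0_norm//.
by rewrite (le_lt_trans int_u)// ltry.
Qed.

Lemma variational_integrable :
  p.-integrable setT (fun t => (psi t)%:E) ->
  p.-integrable setT (fun t => (ln (rp t))%:E) ->
  ((- ln B)%:E <= \int[p]_t (psi t)%:E + KL p q)%E.
Proof.
move=> ipsi ilnr; rewrite KLE.
have := ipsi => /(integrable_fin_num measurableT) fpsi.
have := ilnr => /(integrable_fin_num measurableT) flnr.
apply: (@le_trans _ _ (\int[p]_t (psi t + ln (rp t) + (u t - 1))%:E)%E).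
  have -> : (- ln B)%:E = (\int[p]_t (cst (- ln B)%:E t))%E.
    by rewrite integral_cst// [X in (_ * X)%E]probability_setT mule1.
  apply: le_integral => //.
  - exact: finite_measure_integrable_cst.
  - under eq_fun do rewrite !EFinD; apply: integrableD => //.
      exact: integrableD.
    apply: integrableD => //; exact: finite_measure_integrable_cst.
  - by move=> t _; rewrite lee_fin.
under eq_integral do rewrite !EFinD.
rewrite integralD//; last 2 first.
- exact: integrableD.
- by apply: integrableD => //; exact: finite_measure_integrable_cst.
rewrite integralD// integralD//; last first.
  exact: finite_measure_integrable_cst.
rewrite integral_cst// [X in (_ * X)%E]probability_setT mule1.
rewrite -[leRHS]adde0 leeD2l//.
by rewrite EFinN sube_le0.
Qed.

End potential.

(** The negative part of [ln (rp t)] is at most [(rp t)^-1], whose integral against [p] is the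
    [q]-measure of [D]. Hence the divergence is never an undefined difference of infinities. *)
Let ln_rp_neg : (\int[p]_t (EFin \o (fun t => ln (rp t)))^\- t < +oo)%E.
Proof.
apply: (@le_lt_trans _ _ (\int[p]_t ((rp t)^-1)%:E)%E).
  apply: ge0_le_integral => //.
  - by apply: measurable_funeneg; apply/measurable_EFinP; exact: measurableT_comp.
  - by apply/measurable_EFinP; exact: measurable_funV.
  - move=> t _; rewrite funenegE /= -EFin_max lee_fin ge_max invr_ge0 rp0 andbT.
    have [rpt|] := ltrP 0 (rp t).
      have := ln_ge1Bv rpt; lra.
    by move=> rpt; rewrite ln0// oppr0 invr_ge0.
rewrite int_rp; last 2 first.
- exact: measurable_funV.
- by move=> t; rewrite invr_ge0.
apply: (@le_lt_trans _ _ (\int[q]_t (cst 1 t))%E); last first.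
  by rewrite integral_cst// mul1e [X in (X < _)%E]probability_setT ltry.
apply: ge0_le_integral => //.
- by move=> t _; rewrite lee_fin mulr_ge0// invr_ge0.
- by apply/measurable_EFinP; apply: measurable_funM => //; exact: measurable_funV.
move=> t _; rewrite lee_fin; have [->|r0] := eqVneq (rp t) 0.
  by rewrite mulr0.
by rewrite mulVf.
Qed.

(** If [psi] or [ln (rp t)] is not integrable, the right-hand side is [+oo]: the energy is
    nonnegative and the negative part of the logarithm has finite integral. *)
Lemma variational_le (psi : T -> R) :
  measurable_fun setT psi -> (forall t, 0 <= psi t) ->
  ((- ln (\int[q]_t expR (- psi t)))%:E <= \int[p]_t (psi t)%:E + KL p q)%E.
Proof.
move=> mpsi psi0.
have mlnr : measurable_fun setT (fun t => ln (rp t)) by exact: measurableT_comp.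
have ipsi0 : (0 <= \int[p]_t (psi t)%:E)%E.
  by apply: integral_ge0 => t _; rewrite lee_fin.
have [lnr_pos|] := ltP (\int[p]_t (EFin \o (fun t => ln (rp t)))^\+ t)%E +oo%E; last first.
  rewrite leye_eq => /eqP lnr_pos.
  rewrite (KLE : _ = \int[p]_t (EFin \o (fun t => ln (rp t))) t)%E
    [X in (_ + X)%E]integralE lnr_pos addye ?addey ?leey//.
  - by rewrite gt_eqF// (lt_le_trans _ ipsi0)// ltNyr.
  - by rewrite eqe_oppLR/= lt_eqF.
have ilnr : p.-integrable setT (EFin \o (fun t => ln (rp t))).
  apply/integrableP; split; first exact/measurable_EFinP.
  rewrite -[X in (X < _)%E]/(\int[p]_t (abse \o (EFin \o (fun t => ln (rp t)))) t)%E.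
  rewrite fune_abse ge0_integralD//.
  - by rewrite lte_add_pinfty.
  - by apply: measurable_funepos; exact/measurable_EFinP.
  - by apply: measurable_funeneg; exact/measurable_EFinP.
have [ipsi|] := ltP (\int[p]_t (psi t)%:E)%E +oo%E; last first.
  rewrite leye_eq => /eqP ->; rewrite KLE addye ?leey//.
  by have := integrable_fin_num measurableT ilnr; rewrite fin_numE => /andP[].
apply: variational_integrable => //.
apply/integrableP; split; first exact/measurable_EFinP.
by under eq_integral do rewrite gee0_abs ?lee_fin//.
Qed.

End variational.

(** The free energy [- ln B] separates the two sides. On the left, the divergence of the Gibbs
    measure itself has been dropped, being nonnegative. *)
Lemma gibbs_le p q (psi : T -> R) (B := \int[q]_t expR (- psi t)) :
  measurable_fun setT psi -> (forall t, 0 <= psi t) ->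
  (\int[q]_t (expR (- psi t) / B * psi t)%:E <=
   \int[p]_t (psi t)%:E + KL p q)%E.
Proof.
move=> mpsi psi0.
have [pq|npq] := pselect (p `<< q).
  apply: le_trans (variational_le pq mpsi psi0); exact: gibbs_energy_le.
rewrite /KL; case: asboolP => // _; rewrite addey ?leey//.
have : (0 <= \int[p]_t (psi t)%:E)%E.
  by apply: integral_ge0 => t _; rewrite lee_fin.
by move=> /(lt_le_trans (ltNyr 0)) /gt_eqF ->.
Qed.

Lemma KL_ge0 p q : (0 <= KL p q)%E.
Proof.
have := @gibbs_le p q (cst 0) _ _.
rewrite integral0_eq ?integral0_eq ?add0e//.
- by apply => //; exact: measurable_cst.
- by move=> t _; rewrite /= mulr0.
Qed.

End gibbs.

(** * Independence *)

Section joint_law.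
Local Open Scope ereal_scope.
Context d (Omega : measurableType d) (R : realType) (P : probability Omega R).
Context d' (T : measurableType d').
Variables (X : {RV P >-> R}) (Y : {mfun Omega >-> T}).
Hypothesis XY : forall A B, measurable A -> measurable B ->
  P (X @^-1` A `&` Y @^-1` B) = P (X @^-1` A) * P (Y @^-1` B).

Let YX (w : Omega) : T * R := (Y w, X w).

Let mYX : measurable_fun setT YX.
Proof. by apply: measurable_fun_pair; exact: measurable_funPT. Qed.

Let mfYX : {mfun Omega >-> (T * R)%type} :=
  HB.pack YX (isMeasurableFun.Build _ _ _ _ YX mYX).

Let joint_lawE A : measurable A ->
  (distribution P Y \x distribution P X) A = distribution P mfYX A.
Proof.
apply: product_measure_unique => B C mB mC.
by rewrite muleC; apply: etrans (XY mC mB); rewrite setIC.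
Qed.

Let ge0_integral_joint (h : T * R -> \bar R) :
  measurable_fun setT h -> (forall u, 0 <= h u) ->
  \int[P]_w h (Y w, X w) =
  \int[distribution P Y]_y \int[distribution P X]_z h (y, z).
Proof.
move=> mh h0.
transitivity (\int[distribution P mfYX]_u h u).
  by rewrite ge0_integral_pushforward.
rewrite -(@fubini_tonelli1 _ _ _ _ _ (distribution P Y) (distribution P X) h)//.
apply: eq_measure_integral => A mA _; exact/esym/joint_lawE.
Qed.

Lemma integrable_joint (h : T * R -> \bar R) : measurable_fun setT h ->
  P.-integrable setT (fun w => h (Y w, X w)) ->
  (distribution P Y \x distribution P X).-integrable setT h.
Proof.
move=> mh /integrableP[_ ih]; apply/integrableP; split => //.
apply: le_lt_trans ih; rewrite fubini_tonelli1//; last by exact: measurableT_comp.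
rewrite (ge0_integral_joint (h := abse \o h))//; last by move=> u; exact: abse_ge0.
exact: measurableT_comp.
Qed.

(** Fubini's theorem for the joint law, a product measure by independence. The target of [Y] is an
    arbitrary measurable type: with [Y] the identity onto a coarser sigma-algebra, the inner
    integral is a conditional expectation. *)
Lemma integral_joint (h : T * R -> \bar R) : measurable_fun setT h ->
  P.-integrable setT (fun w => h (Y w, X w)) ->
  \int[P]_w h (Y w, X w) =
  \int[distribution P Y]_y \int[distribution P X]_z h (y, z).
Proof.
move=> mh ih.
rewrite (integral12_prod_meas1 (integrable_joint mh ih)).
transitivity (\int[distribution P mfYX]_u h u).
  by rewrite integral_pushforward.
by apply: eq_measure_integral => A mA _; exact/esym/joint_lawE.
Qed.

End joint_law.

(** * Independence extends from a pi-system to the sigma-algebra it generates *)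

Section sub_sigma_algebra.
Local Open Scope ereal_scope.
Context d (Omega : measurableType d) (R : realType) (P : probability Omega R).
Variable X : {RV P >-> R}.
Variable G : set (set Omega).
Hypotheses (Gm : G `<=` measurable) (GI : setI_closed G) (GT : G setT).
Hypothesis XG : forall A B, measurable A -> G B ->
  P (X @^-1` A `&` B) = P (X @^-1` A) * P B.

Local Notation T := (g_sigma_algebraType G).

Lemma measurable_g_sigma_id : measurable_fun setT (fun w : Omega => w : T).
Proof.
move=> _ B mB; rewrite setTI.
move: B mB; apply: smallest_sub => //; split.
- exact: (measurable0 : measurable (set0 : set Omega)).
- move=> A mA; rewrite setTD.
  exact: (measurableC (mA : measurable (A : set Omega))).
- move=> F mF.
  exact: (bigcup_measurable (fun k _ => mF k : measurable (F k : set Omega))).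
Qed.

Lemma independent_g_sigma A (B : set T) : measurable A -> measurable B ->
  P (X @^-1` A `&` B) = P (X @^-1` A) * P B.
Proof.
move=> mA mB; have mXA : measurable (X @^-1` A).
  by rewrite -[_ @^-1` _]setTI; exact: measurable_funPT.
have PXA : P (X @^-1` A) \is a fin_num by exact: fin_num_measure.
have PXA0 : (0 <= fine (P (X @^-1` A)))%R by exact: fine_ge0.
(* For fixed [A], both sides of the product rule are finite measures in [B]; they agree on the
   pi-system [G], which contains the whole space, hence on what it generates. *)
pose m1 := mrestr P mXA.
pose m2 := mscale (NngNum PXA0) P.
have m1E C : m1 C = P (X @^-1` A `&` C) by rewrite setIC.
have m2E C : m2 C = P (X @^-1` A) * P C by rewrite -[in RHS](fineK PXA).
suff mE : m1 B = m2 B by apply: etrans (esym (m1E B)) (etrans mE (m2E B)).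
apply: (g_sigma_algebra_measure_unique G Gm (fun=> setT)) => //.
- by apply: bigcup_const; exists 0%N.
- by move=> C GC; apply: etrans (m1E C) (etrans (XG mA GC) (esym (m2E C))).
- move=> k; apply: (@le_lt_trans _ _ (P (X @^-1` A `&` setT))).
    by rewrite -m1E.
  by rewrite (le_lt_trans (probability_le1 _ _))// ?ltry// setIT.
Qed.

End sub_sigma_algebra.

Section leave_one_out.
Context d (Omega : measurableType d) (R : realType) (P : probability Omega R).
Context (I : finType) (xi : I -> {RV P >-> R}).
Hypothesis xi_indep : mutually_independent xi.
Variable i : I.

(** A pi-system generating the sigma-algebra of all the noise variables except [xi i]. *)
Definition other_events : set (set Omega) :=
  [set B | exists2 A : I -> set R, (forall j, measurable (A j)) &
    B = \bigcap_(j in [set` (~: [set i])%SET]) xi j @^-1` A j].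

Lemma other_events_measurable : other_events `<=` measurable.
Proof.
move=> _ [A mA ->]; apply: fin_bigcap_measurable => // j _.
by rewrite -[_ @^-1` _]setTI; exact: measurable_funPT.
Qed.

Lemma other_eventsI : setI_closed other_events.
Proof.
move=> _ _ [A mA ->] [B mB ->]; exists (fun j => A j `&` B j).
  by move=> j; exact: measurableI.
by rewrite -bigcapI; apply: eq_bigcapr => j _; rewrite preimage_setI.
Qed.

Lemma other_eventsT : other_events setT.
Proof.
by exists (fun=> setT) => //; apply/esym/bigcapT.
Qed.

(** Mutual independence is applied twice, to the indices other than [i] and to all of them; [D]
    inserts [A] at position [i]. *)
Lemma other_events_independent A B : measurable A -> other_events B ->
  P (xi i @^-1` A `&` B) = (P (xi i @^-1` A) * P B)%E.
Proof.
move=> mA [C mC ->]; rewrite (xi_indep (~: [set i])%SET mC).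
pose D j := if j == i then A else C j.
have mD j : measurable (D j) by rewrite /D; case: ifP.
have -> : xi i @^-1` A `&` \bigcap_(j in [set` (~: [set i])%SET]) xi j @^-1` C j =
    \bigcap_(j in [set` [set: I]%SET]) xi j @^-1` D j.
  apply/seteqP; split => w /=.
    move=> [Aw Cw] j _; rewrite /D /preimage/=; case: ifPn => [/eqP ->//|ji].
    by apply: Cw; rewrite /= finset.in_setC finset.in_set1.
  move=> Dw; split; first by have := Dw i; rewrite /D /preimage/= eqxx; apply.
  move=> j; rewrite /= finset.in_setC finset.in_set1 => ji.
  by have := Dw j; rewrite /D /preimage/= (negbTE ji); apply.
rewrite (xi_indep [set: I]%SET mD) (bigD1 i) ?finset.in_setT//= {1}/D eqxx.
congr (_ * _)%E; apply: eq_big => [j|j /andP[_ ji]].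
  by rewrite finset.in_setT finset.in_setC finset.in_set1.
by rewrite /D (negbTE ji).
Qed.

Lemma measurable_other j : j != i ->
  measurable_fun setT (fun w : g_sigma_algebraType other_events => xi j w).
Proof.
move=> ji _ A mA; rewrite setTI; apply: sub_sigma_algebra.
exists (fun k => if k == j then A else setT).
  by move=> k; case: ifP.
apply/seteqP; split => w /= => [Aw k _|/(_ j)].
  by rewrite /preimage/=; case: ifPn => // /eqP ->.
by rewrite /preimage/= eqxx; apply; rewrite /= finset.in_setC finset.in_set1.
Qed.

End leave_one_out.

(** * Stein's identity *)

Section stein.
Context (R : realType).
Notation mu := (@lebesgue_measure R).

Lemma FTC_is_derive (phi dphi : R -> R) (a b : R) : a < b ->
  (forall t : R, is_derive t 1 phi (dphi t)) -> continuous dphi ->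
  (\int[mu]_(t in `[a, b]) (dphi t)%:E = (phi b - phi a)%:E)%E.
Proof.
move=> ab dp cdp; rewrite EFinB; apply: continuous_FTC2 => //.
- exact: continuous_subspaceT.
- have cphi : continuous phi.
    move=> t; apply: differentiable_continuous; apply/derivable1_diffP.
    by case: (dp t).
  split.
  + by move=> t _; case: (dp t).
  + exact/cvg_at_right_filter/cphi.
  + exact/cvg_at_left_filter/cphi.
- by move=> t _; rewrite derive1E; case: (dp t).
Qed.

(* [z * (phi z - phi 0)] is the integral of [phi' t * stein_kernel (t, z)] over
   t, and [m_fun] is the integral of the kernel over the law of z. *)
Definition stein_kernel (u : R * R) : R :=
  if 0 <= u.1 then (if u.1 < u.2 then u.2 else 0)
  else (if u.2 <= u.1 then - u.2 else 0).

Lemma stein_kernel_ge0 u : 0 <= stein_kernel u.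
Proof.
rewrite /stein_kernel; have [u0|u0] := leP 0 u.1; case: ifP => //.
  by move=> /(le_lt_trans u0)/ltW.
by move=> /le_lt_trans/(_ u0)/ltW; rewrite oppr_ge0.
Qed.

Lemma measurable_stein_kernel : measurable_fun setT stein_kernel.
Proof.
apply: measurable_fun_ifT; first exact: measurable_fun_ler.
- by apply: measurable_fun_ifT => //; exact: measurable_fun_ltr.
- apply: measurable_fun_ifT => //; first exact: measurable_fun_ler.
  exact: measurable_funN.
Qed.

(** In [t], the kernel is the absolute value of [z] times the indicator of the interval between 0
    and [z], closed on the left and open on the right; the fundamental theorem of calculus does the
    rest. *)
Lemma integral_stein_kernel (phi dphi : R -> R) (z : R) :
  (forall t : R, is_derive t 1 phi (dphi t)) -> continuous dphi ->
  (forall t, 0 <= dphi t) ->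
  (\int[mu]_t (dphi t * stein_kernel (t, z))%:E = (z * (phi z - phi 0))%:E)%E.
Proof.
move=> dp cdp dp0.
have mdp : measurable_fun setT (fun t => (dphi t)%:E).
  by apply/measurable_EFinP; exact: continuous_measurable_fun.
have [z0|z0|->] := ltgtP z 0; last 1 first.
- rewrite mul0r integral0_eq// => t _; rewrite /stein_kernel/=.
  by have [t0|t0] := leP 0 t; rewrite ?oppr0 ?if_same mulr0.
- transitivity (\int[mu]_(t in `[z, 0%R[) ((- z)%:E * (dphi t)%:E))%E.
    rewrite [RHS]integral_mkcond; apply: eq_integral => t _.
    rewrite patchE mem_setE in_itv/= /stein_kernel/=.
    have [t0|t0] := leP 0 t; first by rewrite andbF ltNge (le_trans (ltW z0) t0)/= mulr0.

    by rewrite andbT; case: ifP => _; rewrite ?mulr0// mulrC EFinM.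
  rewrite ge0_integralZl//; last 3 first.
  + exact: measurable_funTS.
  + by move=> t _; rewrite lee_fin.
  + by rewrite lee_fin oppr_ge0 ltW.
  rewrite integral_itv_bndo_bndc; last exact: measurable_funTS.
  by rewrite (FTC_is_derive z0 dp cdp) -EFinM; congr EFin; ring.
- transitivity (\int[mu]_(t in `[0%R, z[) (z%:E * (dphi t)%:E))%E.
    rewrite [RHS]integral_mkcond; apply: eq_integral => t _.
    rewrite patchE mem_setE in_itv/= /stein_kernel/=.
    have [t0|t0] := leP 0 t; first by case: ifP => _/=; rewrite ?mulr0// mulrC EFinM.
    by rewrite leNgt (lt_trans t0 z0)/= mulr0.
  rewrite ge0_integralZl//; last 3 first.
  + exact: measurable_funTS.
  + by move=> t _; rewrite lee_fin.
  + by rewrite lee_fin ltW.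
  rewrite integral_itv_bndo_bndc; last exact: measurable_funTS.
  by rewrite (FTC_is_derive z0 dp cdp) -EFinM.
Qed.

Section identity.
Variables (F : probability R R) (m g : R -> R).
Hypothesis mg : measurable_fun setT g.
Hypothesis g0 : forall t, 0 <= g t.
Hypothesis iF : F.-integrable setT (fun z => z%:E).
Hypothesis F0 : (\int[F]_z z%:E = 0)%E.
Hypothesis mE : forall t, m t = - fine (\int[F]_z (z * \1_[set u | u <= t] z)%:E)%E.
Hypothesis mgE : forall a b, a <= b ->
  (\int[mu]_(t in `]a, b]) (m t)%:E = \int[F]_(t in `]a, b]) (g t)%:E)%E.

(** For [t < 0] this is the definition of [m]. For [0 <= t] the zero mean turns minus the integral
    over [z <= t] into the integral over [t < z], where the integrand is nonnegative. *)
Lemma integral_stein_kernel_law t : ((m t)%:E = \int[F]_z (stein_kernel (t, z))%:E)%E.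
Proof.
have mset : measurable [set u : R | u <= t].
  by rewrite -[X in measurable X]setTI; apply: measurable_fun_ler.
have mind : measurable_fun setT (\1_[set u | u <= t] : R -> R) by exact: measurable_indic.
have ii : F.-integrable setT (fun z => (z * \1_[set u | u <= t] z)%:E).
  apply: le_integrable iF => //.
    by apply/measurable_EFinP; exact: measurable_funM.
  move=> z _; rewrite lee_fin normrM ler_piMr// ger0_norm ?indicE ?ler0n//.
  by rewrite lern1; case: (_ \in _).
rewrite mE EFinN fineK; last exact: integrable_fin_num ii.
have indE z : \1_[set u : R | u <= t] z = (z <= t)%R%:R :> R.
  rewrite indicE; have [zt|zt] := leP z t; first by rewrite mem_set.
  by rewrite memNset//= => /(lt_le_trans zt); rewrite ltxx.
rewrite /stein_kernel/=; have [t0|t0] := leP 0 t.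
  transitivity (\int[F]_z (z%:E - (z * \1_[set u | u <= t] z)%:E))%E.
    by rewrite integralB// F0 add0e.
  apply: eq_integral => z _; rewrite indE -EFinB.
  by case: leP => _; rewrite ?mulr1 ?subrr// mulr0 subr0.
rewrite -integralN; last first.
  by apply: fin_num_adde_defl; rewrite fin_numN; exact: (integrable_neg_fin_num _ ii).
apply: eq_integral => z _; rewrite indE -EFinN.
by case: leP => _; rewrite ?mulr1// mulr0 oppr0.
Qed.

Let m0 t : 0 <= m t.
Proof.
rewrite -lee_fin integral_stein_kernel_law integral_ge0// => z _.
by rewrite lee_fin stein_kernel_ge0.
Qed.

Let mm : measurable_fun setT m.
Proof.
apply/measurable_EFinP; rewrite (_ : EFin \o m = fubini_F F (EFin \o stein_kernel)).
  apply: measurable_fun_fubini_tonelli_F.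
    by apply/measurable_EFinP; exact: measurable_stein_kernel.
  by move=> u; rewrite lee_fin stein_kernel_ge0.
by apply/funext => t; rewrite /= integral_stein_kernel_law.
Qed.

Hypothesis g_le : exists M, forall t, g t <= M.

(* The Borel line carries two measurable structures with distinct displays, the
   canonical one of [R] and [measurableTypeR R], where [mu] lives. *)
Let idR : {mfun R >-> measurableTypeR R} :=
  HB.pack (fun z : R => z : measurableTypeR R)
    (isMeasurableFun.Build _ _ _ _ (fun z : R => z : measurableTypeR R)
      (@measurable_id _ R setT)).

(** The two measures agree on half-open intervals, a pi-system generating the Borel sets. *)
Let density_eq (A : set (measurableTypeR R)) : measurable A ->
  density mu mm m0 A = pushforward (density F mg g0) idR A.
Proof.
move=> mA; pose m1 := density mu mm m0; pose m2 := pushforward (density F mg g0) idR.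
have := @measure_unique _ R (measurableTypeR R) (@ocitv R) (fun k : nat => `](- k%:R), k%:R]%classic).
move=> /(_ erefl (@ocitvI R) _ _ m1 m2).
apply => //.
- by move=> k; exists (- k%:R, k%:R).
- by rewrite bigcup_itvT.
- move=> B; rewrite ocitvP => -[->|[[a b] /= ab ->]]; first by rewrite !measure0.
  by rewrite /m1 /m2 /= /density /pushforward mgE// ltW.
- move=> k; rewrite /m1 /= /density mgE//; last by rewrite ge0_cp.
  have [M gM] := g_le.
  apply: integrable_lty => //; apply: (@integrableS _ _ _ F setT) => //.
  apply: measurable_bounded_integrable => //.
    by rewrite (le_lt_trans (probability_le1 _ _))// ltry.
  exists M; split; first exact: num_real.
  by move=> y My t _; rewrite /= ger0_norm// (le_trans (gM t))// ltW.
Qed.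

(** The left-hand side is a double integral of the kernel. Tonelli's theorem integrates it over the
    law first, which produces [m], and [density_eq] then trades [m] with Lebesgue measure for [g]
    with [F]. Both sides may be infinite. *)
Lemma stein_identity (phi dphi : R -> R) :
  (forall t : R, is_derive t 1 phi (dphi t)) -> continuous dphi ->
  (forall t, 0 <= dphi t) ->
  (\int[F]_z (z * (phi z - phi 0))%:E = \int[F]_z (dphi z * g z)%:E)%E.
Proof.
move=> dp cdp dp0.
have mdp : measurable_fun setT dphi by exact: continuous_measurable_fun.
pose h (u : R * R) := (dphi u.1 * stein_kernel u)%:E.
have mh : measurable_fun setT h.
  apply/measurable_EFinP; apply: measurable_funM.
    exact: measurableT_comp.
  exact: measurable_stein_kernel.
have h0 u : (0 <= h u)%E by rewrite lee_fin mulr_ge0// stein_kernel_ge0.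
transitivity (\int[F]_z \int[mu]_t h (t, z))%E.
  by apply: eq_integral => z _; rewrite -(integral_stein_kernel _ dp cdp dp0).
rewrite -(fubini_tonelli (m1 := mu) (m2 := F) h mh h0).
transitivity (\int[mu]_t ((dphi t)%:E * (m t)%:E))%E.
  apply: eq_integral => t _; rewrite /fubini_F integral_stein_kernel_law -ge0_integralZl//.
  - apply/measurable_EFinP; apply: (measurableT_comp measurable_stein_kernel).
    exact: pair1_measurable.
  - by move=> z _; rewrite lee_fin stein_kernel_ge0.
  - by rewrite lee_fin.
rewrite -(ge0_integral_density (mu := mu) (nu := density mu mm m0) mm m0)//; last exact/measurable_EFinP.
rewrite (eq_measure_integral (pushforward (density F mg g0) idR)); last first.
  by move=> A mA _; exact: density_eq.
rewrite ge0_integral_pushforward//; last 2 first.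
- exact/measurable_EFinP.
- by move=> z _; rewrite lee_fin.
rewrite preimage_setT (ge0_integral_density (mu := F) (nu := density F mg g0) mg g0)//.
exact/measurable_EFinP.
Qed.

(** Replacing [phi 0] by [c] adds a multiple of the mean of [F], which is zero. If [v] has infinite
    integral nothing is to be shown; otherwise it makes [z * (phi z - phi 0)] integrable, so the
    integral splits. *)
Lemma stein_le (phi dphi v : R -> R) (c : R) :
  (forall t : R, is_derive t 1 phi (dphi t)) -> continuous dphi ->
  (forall t, 0 <= dphi t) -> measurable_fun setT v ->
  (forall t, dphi t * g t <= v t) ->
  (\int[F]_z (z * (phi z - c))%:E <= \int[F]_z (v z)%:E)%E.
Proof.
move=> dp cdp dp0 mv dgv.
have mphi : measurable_fun setT phi.
  apply: continuous_measurable_fun => t.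
  apply: differentiable_continuous; apply/derivable1_diffP.
  by case: (dp t).
have mdg : measurable_fun setT (fun z => (dphi z * g z)%:E).
  apply/measurable_EFinP; apply: measurable_funM => //.
  exact: continuous_measurable_fun.
have dg0 t : 0 <= dphi t * g t by rewrite mulr_ge0.
have le_v : (\int[F]_z (z * (phi z - phi 0))%:E <= \int[F]_z (v z)%:E)%E.
  rewrite (stein_identity dp cdp dp0); apply: ge0_le_integral => //.
  - by move=> z _; rewrite lee_fin.
  - exact/measurable_EFinP.
  - by move=> z _; rewrite lee_fin.
have [v_oo|] := ltP (\int[F]_z (v z)%:E)%E +oo%E; last first.
  by rewrite leye_eq => /eqP ->; rewrite leey.
have phi_mono z : 0 <= z * (phi z - phi 0).
  rewrite -lee_fin -(integral_stein_kernel _ dp cdp dp0) integral_ge0// => t _.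
  by rewrite lee_fin mulr_ge0// stein_kernel_ge0.
have i1 : F.-integrable setT (fun z => (z * (phi z - phi 0))%:E).
  apply/integrableP; split.
    apply/measurable_EFinP; apply: measurable_funM => //.
    exact: measurable_funB.
  under eq_integral do rewrite gee0_abs ?lee_fin//.
  exact: le_lt_trans v_oo.
have i2 : F.-integrable setT (fun z => ((phi 0 - c) * z)%:E).
  by under eq_fun do rewrite EFinM; exact: integrableZl.
have -> : (\int[F]_z (z * (phi z - c))%:E =
    \int[F]_z ((z * (phi z - phi 0))%:E + ((phi 0 - c) * z)%:E))%E.
  by apply: eq_integral => z _; rewrite -EFinD; congr EFin; ring.
rewrite integralD//; under [X in (_ + X)%E]eq_integral do rewrite EFinM.
by rewrite integralZl// F0 mule0 adde0.
Qed.

End identity.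
End stein.

(** * Exponential families *)

Section laplace_transform.
Context d (T : measurableType d) (R : realType) (mu : {measure set T -> \bar R}).
Variables (h b : T -> R).
Hypothesis ih : forall z, mu.-integrable setT (fun t => (h t * expR (z * b t))%:E).

Local Notation L := (fun z : R => \int[mu]_t (h t * expR (z * b t))).

(** The left-hand side is monotone in [z], in a direction given by the sign of [c]. Summing both
    endpoint values covers both signs and yields one integrable envelope for all [z] within distance
    1 of [a]. *)
Lemma expR_le_endpoints (a z c : R) : `|z - a| <= 1 ->
  expR (z * c) <= expR ((a - 1) * c) + expR ((a + 1) * c).
Proof.
rewrite ler_norml => /andP[za1 za2]; have [c0|c0] := leP 0 c.
  apply: (@le_trans _ _ (expR ((a + 1) * c))); last by rewrite lerDr expR_ge0.
  by rewrite ler_expR ler_wpM2r//; lra.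
apply: (@le_trans _ _ (expR ((a - 1) * c))); last by rewrite lerDl expR_ge0.
by rewrite ler_expR ler_wnM2r ?(ltW c0)//; lra.
Qed.

Let G a t := `|h t * expR ((a - 1) * b t)| + `|h t * expR ((a + 1) * b t)|.

Let iG a : mu.-integrable setT (EFin \o G a).
Proof.
rewrite /G /comp; under eq_fun do rewrite EFinD.
by apply: integrableD => //; exact: (integrable_norm (ih _)).
Qed.

Let G_ub (a z : R) t : `|z - a| <= 1 -> `|h t * expR (z * b t)| <= G a t.
Proof.
move=> za; rewrite /G !normrM -mulrDr ler_wpM2l// !ger0_norm ?expR_ge0//.
exact: expR_le_endpoints.
Qed.

Let near_le1 (a z : R) : z \in `]a - 1, a + 1[ -> `|z - a| <= 1.
Proof.
rewrite in_itv/= => /andP[? ?]; rewrite ler_norml; apply/andP; split; lra.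
Qed.

Lemma laplace_continuous : continuous L.
Proof.
move=> a; apply: (@continuity_under_integral _ _ _ mu
  (fun (z : R) t => h t * expR (z * b t)) setT measurableT (a - 1) (a + 1) _ _ (G a)).
- by move=> z _; exact: ih.
- apply: aeW => t _ z _; apply: cvgMr; apply: continuous_comp; last exact: continuous_expR.
  by apply: cvgMl; exact: cvg_id.
- exact: iG.
- by move=> z Iz; apply: aeW => t _; apply: G_ub; exact: near_le1.
- by rewrite inE/= in_itv/=; apply/andP; split; lra.
Qed.

End laplace_transform.

Section laplace_derivative.
Context d (T : measurableType d) (R : realType) (mu : {measure set T -> \bar R}).
Variables (h b : T -> R).
Hypothesis ih : forall z, mu.-integrable setT (fun t => (h t * expR (z * b t))%:E).
Hypothesis ihb : forall z,
  mu.-integrable setT (fun t => (h t * b t * expR (z * b t))%:E).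

Let L z t := h t * expR (z * b t).

Let dL (z : R) t : is_derive z 1 (L ^~ t) (h t * b t * expR (z * b t)).
Proof.
have dzb : is_derive z 1 (fun z : R => z * b t) (b t).
  have : is_derive z 1 ((@id R) * cst (b t)) (z *: 0 + b t *: 1).
    exact: is_deriveM.
  by rewrite scaler0 add0r [_ *: _]mulr1.
have : is_derive z 1 (cst (h t) * (expR \o (fun z : R => z * b t)))
    (h t *: (expR (z * b t) * b t) + expR (z * b t) *: 0).
  exact: is_deriveM.
rewrite scaler0 addr0 -[_ *: _]/(_ * _) => H.
by rewrite -mulrA [b t * _]mulrC.
Qed.

Lemma is_derive_laplace (a : R) :
  is_derive a 1 (fun z : R => \int[mu]_t (h t * expR (z * b t)))
    (\int[mu]_t (h t * b t * expR (a * b t))).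
Proof.
pose G t := `|h t * b t * expR ((a - 1) * b t)| + `|h t * b t * expR ((a + 1) * b t)|.
have d1L z t : partial1of2 L z t = h t * b t * expR (z * b t).
  by rewrite partial1of2E; case: (dL z t).
have Ia : `]a - 1, a + 1[%classic a.
  by rewrite /= in_itv/=; apply/andP; split; lra.
have iL z : `]a - 1, a + 1[%classic z -> mu.-integrable setT (EFin \o L z).
  by move=> _; exact: ih.
have derL z t : `]a - 1, a + 1[%classic z -> [set: T] t -> derivable (L ^~ t) z 1.
  by move=> _ _; case: (dL z t).
have G_ge0 t : 0 <= G t by rewrite addr_ge0.
have iG : mu.-integrable setT (EFin \o G).
  rewrite /G /comp; under eq_fun do rewrite EFinD.
  by apply: integrableD => //; exact: (integrable_norm (ihb _)).
have GL z t : `]a - 1, a + 1[%classic z -> [set: T] t -> `|partial1of2 L z t| <= G t.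
  rewrite /= in_itv/= => /andP[? ?] _; rewrite d1L.
  rewrite /G !normrM -mulrDr ler_wpM2l ?mulr_ge0// !ger0_norm ?expR_ge0//.
  by apply: expR_le_endpoints; rewrite ler_norml; apply/andP; split; lra.
apply: DeriveDef.
  exact: (derivable_under_integral measurableT Ia iL derL G_ge0 iG GL).
rewrite -derive1E (differentiation_under_integral measurableT Ia iL derL G_ge0 iG GL).
by apply: eq_Rintegral => t _; rewrite -d1L.
Qed.

End laplace_derivative.

Section exponential_family.
Context d (T : measurableType d) (R : realType) (mu : {measure set T -> \bar R}).
Variables (h f : T -> R) (s : R).
Hypotheses (mh : measurable_fun setT h) (mf : measurable_fun setT f).
Local Notation E z t := (expR (z * (s * f t))).
Hypothesis ih0 : forall z, mu.-integrable setT (fun t => (h t * E z t)%:E).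
Hypothesis ih2 : forall z, mu.-integrable setT (fun t => (h t * f t ^+ 2 * E z t)%:E).
Hypothesis h_gt0 : forall z, 0 < \int[mu]_t (h t * E z t).

Local Notation A0 z := (\int[mu]_t (h t * E z t)).
Local Notation A1 z := (\int[mu]_t (h t * f t * E z t)).
Local Notation A2 z := (\int[mu]_t (h t * f t ^+ 2 * E z t)).

Let ih1 z : mu.-integrable setT (fun t => (h t * f t * E z t)%:E).
Proof.
apply: (@le_integrable _ _ _ mu _ measurableT _
    (fun t => (h t * E z t)%:E + (h t * f t ^+ 2 * E z t)%:E)%E).
- apply/measurable_EFinP; apply: measurable_funM; first exact: measurable_funM.
  by do 3 apply: measurableT_comp => //.
- move=> t _; rewrite -EFinD /= lee_fin -mulrDl -[X in (X + _) * _]mulr1.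
  rewrite -mulrDr !normrM [in leRHS](@ger0_norm _ (1 + _)) ?addr_ge0 ?sqr_ge0//.
  rewrite ler_wpM2r// ler_wpM2l// -real_normK ?num_real//.
  by have := sqr_ge0 (`|f t| - 1); have := normr_ge0 (f t); nra.
- exact: integrableD.
Qed.

Let ih1s z : mu.-integrable setT (fun t => (h t * (s * f t) * E z t)%:E).
Proof.
under eq_fun do rewrite mulrCA -mulrA EFinM; exact: integrableZl.
Qed.

Let ih2s z : mu.-integrable setT (fun t => (h t * f t * (s * f t) * E z t)%:E).
Proof.
under eq_fun do rewrite mulrCA -[h _ * _ * _]mulrA -expr2 -mulrA EFinM.
exact: integrableZl.
Qed.

(** Differentiating under the integral gives [s * A1] for [A0] and [s * A2] for [A1]; the quotient
    rule then shows [s] times the variance of [f]. *)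
Lemma is_derive_exp_family_mean (a : R) :
  is_derive a 1 (fun z : R => A1 z / A0 z)
    (s * (A2 a / A0 a - (A1 a / A0 a) ^+ 2)).
Proof.
have d0 : is_derive a 1 (fun z : R => A0 z) (s * A1 a).
  rewrite -RintegralZl//; last exact: ih1.
  have := is_derive_laplace ih0 ih1s a.
  by congr is_derive; apply: eq_Rintegral => t _; ring.
have d1 : is_derive a 1 (fun z : R => A1 z) (s * A2 a).
  rewrite -RintegralZl//; last exact: ih2.
  have := is_derive_laplace ih1 ih2s a.
  by congr is_derive; apply: eq_Rintegral => t _; ring.
have A0a : A0 a != 0 by rewrite gt_eqF.
have dV := is_deriveV A0a d0.
have : is_derive a 1 ((fun z : R => A1 z) * (fun z : R => (A0 z)^-1))
    (A1 a *: (- (A0 a) ^- 2 *: (s * A1 a)) + (A0 a)^-1 *: (s * A2 a)).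
  exact: is_deriveM.
rewrite -![_ *: _]/(_ * _) => H.
rewrite (_ : s * _ = A1 a * (- A0 a ^- 2 * (s * A1 a)) + (A0 a)^-1 * (s * A2 a))//.
by field.
Qed.

Lemma continuous_exp_family_var :
  continuous (fun z : R => s * (A2 z / A0 z - (A1 z / A0 z) ^+ 2)).
Proof.
have c0 : continuous (fun z : R => A0 z) by exact: laplace_continuous.
have c1 : continuous (fun z : R => A1 z) by exact: laplace_continuous.
have c2 : continuous (fun z : R => A2 z) by exact: laplace_continuous.
move=> z.
have cV : {for z, continuous (fun z : R => (A0 z)^-1)}.
  by apply: cvgV; [rewrite gt_eqF|exact: c0].
rewrite /continuous_at; apply: cvgM; first exact: cvg_cst.
apply: cvgB; first by apply: cvgM; [exact: c2|exact: cV].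
by apply: cvgM; apply: cvgM; [exact: c1|exact: cV|exact: c1|exact: cV].
Qed.

End exponential_family.

(** * The Gibbs posterior *)

(** The sections need not be integrable: Tonelli's theorem makes the integrals of the positive and
    negative parts measurable, and subtraction and [fine] preserve measurability. *)
Lemma measurable_Rintegral2 d d' (U : measurableType d) (T : measurableType d')
    (R : realType) (q : probability T R) (h : U -> T -> R) :
  measurable_fun setT (fun v : U * T => h v.1 v.2) ->
  measurable_fun setT (fun u => \int[q]_t h u t).
Proof.
move=> mh; apply: (measurableT_comp (fine_measurable measurableT)).
under eq_fun do rewrite integralE.
have mhE : measurable_fun setT (fun v : U * T => (h v.1 v.2)%:E).
  exact/measurable_EFinP.
apply: emeasurable_funB.
- rewrite (_ : (fun u => _) = fubini_F q (fun v : U * T => (h v.1 v.2)%:E)^\+%E).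
    apply: measurable_fun_fubini_tonelli_F; first exact: measurable_funepos.
    exact: funepos_ge0.
  by apply/funext => u; apply: eq_integral => t _; rewrite !funeposE.
- rewrite (_ : (fun u => _) = fubini_F q (fun v : U * T => (h v.1 v.2)%:E)^\-%E).
    apply: measurable_fun_fubini_tonelli_F; first exact: measurable_funeneg.
    exact: funeneg_ge0.
  by apply/funext => u; apply: eq_integral => t _; rewrite !funenegE.
Qed.

Section posterior.
Context (R : realType) (X : Type) (n : nat) (n_gt0 : (0 < n)%N) (x : 'I_n -> X).
Context d (Lambda : measurableType d) (fam : Lambda -> X -> R).
Hypothesis fam_meas : forall t : X, measurable_fun [set: Lambda] (fun l => fam l t).
Context (prior : probability Lambda R) (beta : R) (beta_gt0 : 0 < beta).
Hypothesis theta_int : forall (y : 'rV[R]_n) (i : 'I_n),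
  prior.-integrable [set: Lambda]
    (fun l => (theta x fam beta prior y l * fam l (x i) ^+ 2)%:E).
Implicit Types (y : 'rV[R]_n) (i : 'I_n) (l : Lambda).

Definition potential y l : R := n%:R * sqdist_vec x y (fam l) / beta.

Definition posterior_mean y i : R := aggregate x fam beta prior y (x i).

Definition posterior_moment2 y i : R :=
  \int[prior]_l (theta x fam beta prior y l * fam l (x i) ^+ 2).

Definition posterior_var y i : R :=
  posterior_moment2 y i - posterior_mean y i ^+ 2.

Local Notation B y := (\int[prior]_l expR (- potential y l)).

Lemma potentialE y l :
  potential y l = (\sum_i (y 0 i - fam l (x i)) ^+ 2) / beta.
Proof.
by rewrite /potential /sqdist_vec mulrA mulfV ?mul1r// pnatr_eq0 -lt0n.
Qed.

Lemma potential_ge0 y l : 0 <= potential y l.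
Proof. by rewrite potentialE divr_ge0 ?(ltW beta_gt0)// sumr_ge0// => i _; exact: sqr_ge0. Qed.

Lemma measurable_potential y : measurable_fun setT (potential y).
Proof.
rewrite (funext (potentialE y)).
apply: measurable_funM => //; apply: measurable_sum => i.
by apply: measurable_funX; exact: measurable_funB.
Qed.

Lemma thetaE y l :
  theta x fam beta prior y l = expR (- potential y l) / B y.
Proof.
rewrite /theta mulNr; congr (_ / _).
by apply: eq_Rintegral => l' _; rewrite mulNr.
Qed.

Lemma partition_potential_gt0 y : 0 < B y.
Proof. exact: partition_gt0 (measurable_potential y) (potential_ge0 y). Qed.

Lemma theta_ge0 y l : 0 <= theta x fam beta prior y l.
Proof. by rewrite thetaE divr_ge0 ?expR_ge0// ltW// partition_potential_gt0. Qed.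

Lemma integrable_expRN_potential y :
  prior.-integrable setT (EFin \o (fun l => expR (- potential y l))).
Proof. exact: integrable_expRN (measurable_potential y) (potential_ge0 y). Qed.

Lemma integrable_theta y :
  prior.-integrable setT (EFin \o theta x fam beta prior y).
Proof.
apply: eq_integrable (integrableZl measurableT (B y)^-1 (integrable_expRN_potential y)) => //.
by move=> l _; rewrite /= thetaE mulrC EFinM.
Qed.

Lemma Rintegral_theta y : \int[prior]_l theta x fam beta prior y l = 1.
Proof.
under eq_Rintegral do rewrite thetaE.
rewrite RintegralZr//; last exact: integrable_expRN_potential.
by rewrite mulfV// gt_eqF// partition_potential_gt0.
Qed.

Lemma measurable_theta y : measurable_fun setT (theta x fam beta prior y).
Proof. exact/measurable_EFinP/measurable_int/integrable_theta. Qed.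

Lemma integrable_theta_fam y i :
  prior.-integrable setT
    (EFin \o (fun l => theta x fam beta prior y l * fam l (x i))).
Proof.
apply: (@le_integrable _ _ _ prior _ measurableT _
    (fun l => (theta x fam beta prior y l)%:E +
              (theta x fam beta prior y l * fam l (x i) ^+ 2)%:E)%E).
- by apply/measurable_EFinP; apply: measurable_funM => //; exact: measurable_theta.
- move=> l _; rewrite -EFinD /= lee_fin -[X in X + _]mulr1 -mulrDr !normrM.
  rewrite (@ger0_norm _ (1 + _)) ?addr_ge0 ?sqr_ge0// ler_wpM2l//.
  rewrite -real_normK ?num_real//.
  by have := sqr_ge0 (`|fam l (x i)| - 1); have := normr_ge0 (fam l (x i)); nra.
- by apply: integrableD => //; exact: integrable_theta.
Qed.

(** Bias-variance decomposition under the posterior, obtained by expanding the square since [theta]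
    has total mass 1. *)
Lemma Rintegral_theta_sqr y i (c : R) :
  prior.-integrable setT
    (EFin \o (fun l => theta x fam beta prior y l * (c - fam l (x i)) ^+ 2)) /\
  \int[prior]_l (theta x fam beta prior y l * (c - fam l (x i)) ^+ 2) =
  (c - posterior_mean y i) ^+ 2 + posterior_var y i.
Proof.
have it := integrable_theta y; have itf := integrable_theta_fam y i.
have itf2 := theta_int y i.
pose th := theta x fam beta prior y; pose f l := fam l (x i).
have E l : th l * (c - f l) ^+ 2 =
    c ^+ 2 * th l + - (2 * c) * (th l * f l) + th l * f l ^+ 2 by ring.
have i0 : prior.-integrable setT (EFin \o (fun l => c ^+ 2 * th l)).
  by rewrite /comp; under eq_fun do rewrite EFinM; exact: integrableZl.
have i1 : prior.-integrable setT (EFin \o (fun l => - (2 * c) * (th l * f l))).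
  by rewrite /comp; under eq_fun do rewrite EFinM; exact: integrableZl.
have i01 : prior.-integrable setT
    (EFin \o (fun l => c ^+ 2 * th l + - (2 * c) * (th l * f l))).
  by rewrite /comp; under eq_fun do rewrite EFinD; exact: integrableD.
split.
  rewrite /comp; under eq_fun do rewrite E EFinD; exact: integrableD.
under eq_Rintegral do rewrite E.
rewrite RintegralD// RintegralD// RintegralZl// RintegralZl// Rintegral_theta.
rewrite /posterior_var -/(posterior_moment2 y i) -/(aggregate x fam beta prior y (x i)).
by rewrite -/(posterior_mean y i); ring.
Qed.

Lemma posterior_var_ge0 y i : 0 <= posterior_var y i.
Proof.
have [_] := Rintegral_theta_sqr y i (posterior_mean y i).
rewrite subrr expr0n/= add0r => <-; apply: Rintegral_ge0 => l _.
by rewrite mulr_ge0 ?theta_ge0// sqr_ge0.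
Qed.

(** In [gibbs_le] the Gibbs measure of the potential is the posterior, and its mean energy splits
    coordinate by coordinate into squared bias and variance. *)
Lemma posterior_gibbs (p : probability Lambda R) y :
  (((\sum_i ((y 0 i - posterior_mean y i) ^+ 2 + posterior_var y i)) / beta)%:E
   <= \int[p]_l (potential y l)%:E + KL p prior)%E.
Proof.
apply: le_trans (gibbs_le p prior (measurable_potential y) (potential_ge0 y)).
under [leRHS]eq_integral do rewrite -thetaE.
have E l : theta x fam beta prior y l * potential y l =
  \sum_i beta^-1 * (theta x fam beta prior y l * (y 0 i - fam l (x i)) ^+ 2).
  by rewrite potentialE mulrA mulrC mulr_sumr mulr_sumr.
under eq_integral do rewrite E -sumEFin.
have ii i : prior.-integrable setT (fun l =>
    (beta^-1 * (theta x fam beta prior y l * (y 0 i - fam l (x i)) ^+ 2))%:E).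
  under eq_fun do rewrite EFinM; apply: integrableZl => //.
  by have [] := Rintegral_theta_sqr y i (y 0 i).
rewrite (integral_sum measurableT)//.
rewrite [leRHS](eq_bigr (fun i =>
  (beta^-1 * ((y 0 i - posterior_mean y i) ^+ 2 + posterior_var y i))%:E)).
  by rewrite sumEFin lee_fin -mulr_sumr mulrC.
move=> i _; have [iq Eq] := Rintegral_theta_sqr y i (y 0 i).
under eq_integral do rewrite EFinM.
by rewrite integralZl// EFinM -Eq /Rintegral fineK//; exact: integrable_fin_num.
Qed.

Definition replace_coord y i (a : R) : 'rV[R]_n :=
  \row_j (if j == i then a else y 0 j).

(** The square of [fam l (x i)] does not interact with the shift [z]. Up to a term free of [l], the
    potential changes linearly in [z], which makes the posterior an exponential family in that
    coordinate. *)
Lemma potential_replace_coord y i (c z : R) l :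
  potential (replace_coord y i (c + z)) l =
  potential (replace_coord y i c) l + (z ^+ 2 + 2 * z * c) / beta
  - z * (2 / beta * fam l (x i)).
Proof.
rewrite !potentialE (bigD1 i)//= [in RHS](bigD1 i)//= !mxE eqxx.
rewrite [in RHS](eq_bigr (fun j => (replace_coord y i (c + z) 0 j - fam l (x j)) ^+ 2)).
  ring.
by move=> j /negbTE ji; rewrite !mxE ji.
Qed.

(** * The posterior as an exponential family in one observation *)

Section smoothness.
Variables (y : 'rV[R]_n) (i : 'I_n) (c : R).
Let Y z := replace_coord y i (c + z).
Let h l := expR (- potential (replace_coord y i c) l).
Let f l := fam l (x i).
Let s := 2 / beta.
(** The factor of the weight common to all [l]; it cancels under normalisation. *)
Let K z := expR (- ((z ^+ 2 + 2 * z * c) / beta)).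

Let K_gt0 z : 0 < K z. Proof. exact: expR_gt0. Qed.

Let weightE z l : expR (- potential (Y z) l) = K z * (h l * expR (z * (s * f l))).
Proof.
rewrite potential_replace_coord /K /h -!expRD; congr expR; rewrite /s /f; ring.
Qed.

(** Posterior integrability is assumed at every observation vector, in particular at every [Y z].
    Undoing the normalisation yields integrability of the exponential family at every real
    parameter. *)
Let int_h (g : Lambda -> R) z :
  prior.-integrable setT (fun l => (theta x fam beta prior (Y z) l * g l)%:E) ->
  prior.-integrable setT (fun l => (h l * g l * expR (z * (s * f l)))%:E).
Proof.
move=> ig.
apply: eq_integrable (integrableZl measurableT (B (Y z) / K z) ig) => // l _ /=.
rewrite -EFinM thetaE weightE; congr EFin; field.
by rewrite !gt_eqF// partition_potential_gt0.
Qed.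

Let ih0 z : prior.-integrable setT (fun l => (h l * expR (z * (s * f l)))%:E).
Proof.
have i1 : prior.-integrable setT
    (fun l => (theta x fam beta prior (Y z) l * cst 1 l)%:E).
  apply: eq_integrable (integrable_theta (Y z)) => // l _.
  by rewrite /= mulr1.
by apply: eq_integrable (int_h i1) => // l _; rewrite /= mulr1.
Qed.

Let ih2 z :
  prior.-integrable setT (fun l => (h l * f l ^+ 2 * expR (z * (s * f l)))%:E).
Proof. by apply: int_h; exact: theta_int. Qed.

Let mh : measurable_fun setT h.
Proof. exact: measurable_expRN (measurable_potential _). Qed.

Let BE z : B (Y z) = K z * \int[prior]_l (h l * expR (z * (s * f l))).
Proof.
rewrite -RintegralZl//; last exact: ih0.
by apply: eq_Rintegral => l _; exact: weightE.
Qed.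

Let A0_gt0 z : 0 < \int[prior]_l (h l * expR (z * (s * f l))).
Proof. by have := partition_potential_gt0 (Y z); rewrite BE pmulr_rgt0. Qed.

Let moment (g : Lambda -> R) z :
  prior.-integrable setT (fun l => (h l * g l * expR (z * (s * f l)))%:E) ->
  \int[prior]_l (theta x fam beta prior (Y z) l * g l) =
  (\int[prior]_l (h l * g l * expR (z * (s * f l)))) /
  \int[prior]_l (h l * expR (z * (s * f l))).
Proof.
move=> ig; rewrite -RintegralZr//; apply: eq_Rintegral => l _.
rewrite thetaE weightE BE; field.
by rewrite !gt_eqF.
Qed.

Let meanE z : posterior_mean (Y z) i =
  (\int[prior]_l (h l * f l * expR (z * (s * f l)))) /
  \int[prior]_l (h l * expR (z * (s * f l))).
Proof. by apply: moment; apply: int_h; exact: integrable_theta_fam. Qed.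

Let varE z : posterior_var (Y z) i =
  (\int[prior]_l (h l * f l ^+ 2 * expR (z * (s * f l)))) /
   (\int[prior]_l (h l * expR (z * (s * f l)))) -
  ((\int[prior]_l (h l * f l * expR (z * (s * f l)))) /
   \int[prior]_l (h l * expR (z * (s * f l)))) ^+ 2.
Proof.
rewrite /posterior_var meanE; congr (_ - _).
by apply: (moment (g := fun l => f l ^+ 2)); exact: ih2.
Qed.

Lemma is_derive_posterior_mean (z : R) :
  is_derive z 1 (fun z : R => posterior_mean (replace_coord y i (c + z)) i)
    (2 / beta * posterior_var (replace_coord y i (c + z)) i).
Proof.
rewrite -/(Y z) varE.
rewrite (_ : (fun z : R => _) = fun z : R => posterior_mean (Y z) i)//.
under eq_fun do rewrite meanE.
exact: (is_derive_exp_family_mean mh (fam_meas _) ih0 ih2 A0_gt0).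
Qed.

Lemma continuous_posterior_var :
  continuous (fun z : R => 2 / beta * posterior_var (replace_coord y i (c + z)) i).
Proof.
rewrite (_ : (fun z : R => _) = fun z : R => s * posterior_var (Y z) i)//.
under eq_fun do rewrite varE.
exact: (continuous_exp_family_var mh (fam_meas _) ih0 ih2 A0_gt0).
Qed.

End smoothness.

(** * Measurability of posterior moments in the data *)

Section measurability.
Context d' (U : measurableType d') (Y : U -> 'rV[R]_n).
Hypothesis mY : forall i, measurable_fun setT (fun u => Y u 0 i).

Let mtheta : measurable_fun setT
  (fun v : U * Lambda => theta x fam beta prior (Y v.1) v.2).
Proof.
have mw : measurable_fun setT (fun v : U * Lambda => expR (- potential (Y v.1) v.2)).
  apply: measurableT_comp => //; apply: measurable_funN.
  under eq_fun do rewrite potentialE.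
  apply: measurable_funM => //; apply: measurable_sum => i.
  apply: measurable_funX; apply: measurable_funB.
    exact: (measurableT_comp (mY i) measurable_fst).
  exact: (measurableT_comp (fam_meas (x i)) measurable_snd).
under eq_fun do rewrite thetaE.
apply: measurable_funM => //; apply: measurable_funV.
have := @measurable_Rintegral2 _ _ U Lambda R prior (fun u l => expR (- potential (Y u) l)) mw.
by move=> /measurableT_comp; apply; exact: measurable_fst.
Qed.

Lemma measurable_posterior_mean i :
  measurable_fun setT (fun u => posterior_mean (Y u) i).
Proof.
apply: measurable_Rintegral2; apply: measurable_funM => //.
exact: (measurableT_comp (fam_meas (x i)) measurable_snd).
Qed.

Lemma measurable_posterior_var i :
  measurable_fun setT (fun u => posterior_var (Y u) i).
Proof.
apply: measurable_funB; last by apply: measurable_funX; exact: measurable_posterior_mean.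
apply: measurable_Rintegral2; apply: measurable_funM => //.
by apply: measurable_funX; exact: (measurableT_comp (fam_meas (x i)) measurable_snd).
Qed.

End measurability.

End posterior.

(** * Risk bound *)

Section risk_bound.
Context (R : realType) (X : Type) (n : nat) (n_gt0 : (0 < n)%N) (x : 'I_n -> X)
  (f : X -> R).
Context (dO : measure_display) (Omega : measurableType dO) (P : probability Omega R)
  (xi : 'I_n -> {RV P >-> R}).
Hypotheses (xi_iid : iid xi) (xi_mean0 : forall i, ('E_P[xi i] = 0)%E).
Context (dL : measure_display) (Lambda : measurableType dL)
  (fam : Lambda -> X -> R).
Hypothesis fam_meas : forall t : X, measurable_fun [set: Lambda] (fun l => fam l t).
Context (prior : probability Lambda R) (beta : R) (beta_gt0 : 0 < beta).
Hypothesis theta_int : forall (y : 'rV[R]_n) (i : 'I_n),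
  prior.-integrable [set: Lambda]
    (fun l => (theta x fam beta prior y l * fam l (x i) ^+ 2)%:E).
Variable sigma : R.
Let i0 := Ordinal n_gt0.
Hypothesis xi_var : ('E_P[fun w => (xi i0 w ^+ 2)%R] = (sigma ^+ 2)%:E)%E.
Variable g : R -> R.
Hypotheses (g_ge0 : forall z, 0 <= g z) (g_meas : measurable_fun [set: R] g).
Hypothesis g_le : forall z, 4 * g z <= beta.
Hypothesis g_density : forall a b, a <= b ->
  (\int[lebesgue_measure]_(z in `]a, b]) (m_fun (xi i0) z)%:E =
   \int[distribution P (xi i0)]_(z in `]a, b]) (g z)%:E)%E.

Local Notation obs := (observations x f xi).
Local Notation mean := (posterior_mean x fam prior beta).
Local Notation var := (posterior_var x fam prior beta).

(** The variance and the density [g] are given for the noise variable [xi i0] only; equality of laws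
    carries them to every coordinate. *)
Let int_law i (h : R -> \bar R) :
  (\int[distribution P (xi i)]_z h z = \int[distribution P (xi i0)]_z h z)%E.
Proof. by apply: eq_measure_integral => A mA _; exact: xi_iid.2. Qed.

Lemma integrable_noise_sqr i : P.-integrable setT (fun w => (xi i w ^+ 2)%:E).
Proof.
have mX : measurable_fun setT (fun z : R => (z ^+ 2)%:E).
  by apply/measurable_EFinP; exact: exprn_measurable.
have E j : (\int[P]_w (xi j w ^+ 2)%:E = \int[distribution P (xi j)]_z (z ^+ 2)%:E)%E.
  rewrite ge0_integral_pushforward//.
  by move=> z _; rewrite lee_fin sqr_ge0.
apply/integrableP; split.
  by apply/measurable_EFinP; apply: measurable_funX; exact: measurable_funPT.
under eq_integral do rewrite gee0_abs ?lee_fin ?sqr_ge0//.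
rewrite E int_law -E; move: xi_var; rewrite unlock => ->; exact: ltry.
Qed.

Lemma integrable_noise i : P.-integrable setT (fun w => (xi i w)%:E).
Proof.
apply: (@le_integrable _ _ _ P _ measurableT _
    (fun w => 1%:E + (xi i w ^+ 2)%:E)%E).
- by apply/measurable_EFinP; exact: measurable_funPT.
- move=> w _; rewrite -EFinD /= lee_fin [leRHS]ger0_norm ?addr_ge0 ?sqr_ge0//.
  rewrite -real_normK ?num_real//.
  by have := sqr_ge0 (`|xi i w| - 1); have := normr_ge0 (xi i w); nra.
- apply: integrableD => //; last exact: integrable_noise_sqr.
  exact: finite_measure_integrable_cst.
Qed.

Lemma measurable_obs i : measurable_fun setT (fun w => obs w 0 i).
Proof.
under eq_fun do rewrite mxE.
by apply: measurable_funD => //; exact: measurable_funPT.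
Qed.

Let integrable_law : (distribution P (xi i0)).-integrable setT (fun z => z%:E).
Proof.
apply/integrableP; split; first exact/measurable_EFinP.
rewrite ge0_integral_pushforward//; first by have /integrableP[] := integrable_noise i0.
by apply: measurableT_comp => //; exact/measurable_EFinP.
Qed.

Let law_mean0 : (\int[distribution P (xi i0)]_z z%:E = 0)%E.
Proof.
have := xi_mean0 i0; rewrite unlock => <-.
by rewrite integral_pushforward//; exact: integrable_noise.
Qed.

Let m_funE t : m_fun (xi i0) t =
  - fine (\int[distribution P (xi i0)]_z (z * \1_[set u | u <= t] z)%:E)%E.
Proof.
have mset : measurable [set u : R | u <= t].
  by rewrite -[X in measurable X]setTI; apply: measurable_fun_ler.
have mh : measurable_fun setT (fun z : R => (z * \1_[set u | u <= t] z)%:E).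
  apply/measurable_EFinP; apply: measurable_funM => //; exact: measurable_indic.
rewrite /m_fun unlock; congr (- fine _).
rewrite integral_pushforward//.
apply: le_integrable (integrable_noise i0) => //.
  by apply: measurableT_comp mh _; exact: measurable_funPT.
move=> w _; rewrite /= lee_fin normrM ler_piMr// ger0_norm ?indicE ?ler0n//.
by rewrite lern1; case: (_ \in _).
Qed.

(** With the other coordinates frozen, [stein_le] applies to the posterior mean as a function of the
    noise. Its derivative is [2 / beta] times the variance, so domination by half the variance
    amounts to [4 * g t <= beta]. *)
Lemma stein_conditional (y : 'rV[R]_n) i (c : R) :
  (\int[distribution P (xi i)]_z
     (z * (mean (replace_coord y i (f (x i) + z)) i - c))%:E <=
   \int[distribution P (xi i)]_z
     (2^-1 * var (replace_coord y i (f (x i) + z)) i)%:E)%E.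
Proof.
rewrite [leLHS]int_law [leRHS]int_law.
have gM : exists M, forall t, g t <= M.
  by exists (4^-1 * beta) => t; have := g_le t; lra.
have cV := continuous_posterior_var n_gt0 fam_meas beta_gt0 theta_int
  (y := y) (i := i) (c := f (x i)).
have dM (z : R) := is_derive_posterior_mean n_gt0 fam_meas beta_gt0 theta_int
  y i (f (x i)) z.
have V0 z := posterior_var_ge0 n_gt0 fam_meas beta_gt0 theta_int
  (replace_coord y i (f (x i) + z)) i.
apply: (stein_le g_meas g_ge0 integrable_law law_mean0 m_funE g_density gM c dM cV).
- by move=> t; rewrite mulr_ge0// divr_ge0// ltW.
- rewrite (_ : (fun z => _) = fun z =>
    (beta / 4) * (2 / beta * var (replace_coord y i (f (x i) + z)) i)).
    by apply: measurable_funM => //; exact: continuous_measurable_fun.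
  by apply/funext => z; field; rewrite gt_eqF.
- move=> t; rewrite -mulrA mulrC mulrA -subr_ge0.
  rewrite (_ : _ - _ = var (replace_coord y i (f (x i) + t)) i * ((beta - 4 * g t) / (2 * beta))).
    by rewrite mulr_ge0// divr_ge0 ?subr_ge0// mulr_ge0// ltW.
  by field; rewrite gt_eqF.
Qed.

(** Fubini's theorem separates [xi i] from the other noise variables, and [stein_conditional] is
    integrated over the latter. *)
Lemma stein_coord i (c : R) :
  P.-integrable setT (fun w => (xi i w * (mean (obs w) i - c))%:E) ->
  P.-integrable setT (fun w => (2^-1 * var (obs w) i)%:E) ->
  (\int[P]_w (xi i w * (mean (obs w) i - c))%:E <=
   \int[P]_w (2^-1 * var (obs w) i)%:E)%E.
Proof.
pose T := g_sigma_algebraType (other_events xi i).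
have mid : measurable_fun setT (fun w : Omega => w : T).
  exact: measurable_g_sigma_id (@other_events_measurable _ _ _ _ _ xi i).
pose Z : {mfun Omega >-> T} := HB.pack (fun w : Omega => w : T)
  (isMeasurableFun.Build _ _ _ _ (fun w : Omega => w : T) mid).
have XZ A B : measurable A -> measurable B ->
    (P (xi i @^-1` A `&` Z @^-1` B) = P (xi i @^-1` A) * P (Z @^-1` B))%E.
  move=> mA mB; apply: (independent_g_sigma (G := other_events xi i)) => //.
  - exact: other_events_measurable.
  - exact: other_eventsI.
  - exact: other_eventsT.
  - by move=> A' B'; exact: (other_events_independent xi_iid.1).
(* [xi i] need not be measurable for the sigma-algebra of [T]; overwriting coordinate [i] with the
   second component makes [Yv] jointly measurable. *)
pose Yv (u : T * R) := replace_coord (obs u.1) i (f (x i) + u.2).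
have YvE w : Yv (Z w, xi i w) = obs w.
  by apply/rowP => j; rewrite !mxE; case: eqP => [->|].
have mYv j : measurable_fun setT (fun u => Yv u 0 j).
  under eq_fun do rewrite !mxE.
  have [ji|ji] := boolP (j == i); first exact: measurable_funD.
  apply: measurable_funD => //.
  exact: (measurableT_comp (measurable_other ji) measurable_fst).
pose h1 (u : T * R) := (u.2 * (mean (Yv u) i - c))%:E.
pose h2 (u : T * R) := (2^-1 * var (Yv u) i)%:E.
have mh1 : measurable_fun setT h1.
  apply/measurable_EFinP; apply: measurable_funM => //.
  apply: measurable_funB => //.
  exact: measurable_posterior_mean.
have mh2 : measurable_fun setT h2.
  apply/measurable_EFinP; apply: measurable_funM => //.
  exact: measurable_posterior_var.
have E1 w : (xi i w * (mean (obs w) i - c))%:E = h1 (Z w, xi i w).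
  by rewrite /h1 YvE.
have E2 w : (2^-1 * var (obs w) i)%:E = h2 (Z w, xi i w).
  by rewrite /h2 YvE.
move=> i1 i2.
have ih1 : P.-integrable setT (fun w => h1 (Z w, xi i w)).
  by apply: eq_integrable i1 => // w _; exact: E1.
have ih2 : P.-integrable setT (fun w => h2 (Z w, xi i w)).
  by apply: eq_integrable i2 => // w _; exact: E2.
rewrite [leLHS](eq_integral (fun w => h1 (Z w, xi i w))); last by move=> w _; exact: E1.
rewrite [leRHS](eq_integral (fun w => h2 (Z w, xi i w))); last by move=> w _; exact: E2.
rewrite (integral_joint XZ mh1 ih1) (integral_joint XZ mh2 ih2).
apply: le_integral => //.
- exact: (integrable_fubini_F (integrable_joint XZ mh1 ih1)).
- exact: (integrable_fubini_F (integrable_joint XZ mh2 ih2)).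
- by move=> u _; have := stein_conditional (obs u) i c; rewrite /h1 /h2 /Yv; apply.
Qed.

End risk_bound.

(** * Taking expectations when the risk of [p] and its divergence are finite *)

Section finite_kl.
Context (R : realType) (X : Type) (n : nat) (n_gt0 : (0 < n)%N) (x : 'I_n -> X)
  (f : X -> R).
Context (dO : measure_display) (Omega : measurableType dO) (P : probability Omega R)
  (xi : 'I_n -> {RV P >-> R}).
Hypothesis ixi : forall i, P.-integrable setT (fun w => (xi i w)%:E).
Hypothesis ixi2 : forall i, P.-integrable setT (fun w => (xi i w ^+ 2)%:E).
Context (dL : measure_display) (Lambda : measurableType dL)
  (fam : Lambda -> X -> R).
Hypothesis fam_meas : forall t : X, measurable_fun [set: Lambda] (fun l => fam l t).
Context (prior : probability Lambda R) (beta : R) (beta_gt0 : 0 < beta).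
Hypothesis theta_int : forall (y : 'rV[R]_n) (i : 'I_n),
  prior.-integrable [set: Lambda]
    (fun l => (theta x fam beta prior y l * fam l (x i) ^+ 2)%:E).
Context (p : probability Lambda R).

Local Notation obs := (observations x f xi).
Local Notation mean := (posterior_mean x fam prior beta).
Local Notation var := (posterior_var x fam prior beta).

Hypothesis stein_coord : forall i (c : R),
  P.-integrable setT (fun w => (xi i w * (mean (obs w) i - c))%:E) ->
  P.-integrable setT (fun w => (2^-1 * var (obs w) i)%:E) ->
  (\int[P]_w (xi i w * (mean (obs w) i - c))%:E <=
   \int[P]_w (2^-1 * var (obs w) i)%:E)%E.

Hypothesis mobs : forall i, measurable_fun setT (fun w => obs w 0 i).
Hypothesis ip : forall i, p.-integrable setT (fun l => ((fam l (x i) - f (x i)) ^+ 2)%:E).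
Variable K : R.
Hypothesis KLK : KL p prior = K%:E.

Let err l i := fam l (x i) - f (x i).
(** Errors are centred at [f], so the mean of [fam l (x i)] under [p] is [f (x i) + e1 i]. *)
Let e1 i := \int[p]_l err l i.
Let e2 i := \int[p]_l (err l i ^+ 2).
Let V i w := var (obs w) i.
Let M i w := mean (obs w) i - f (x i).

Let ie1 i : p.-integrable setT (EFin \o (err^~ i)).
Proof.
apply: (@le_integrable _ _ _ p _ measurableT _
    (fun l => 1%:E + (err l i ^+ 2)%:E)%E).
- by apply/measurable_EFinP; exact: measurable_funB.
- move=> l _; rewrite -EFinD /= lee_fin [leRHS]ger0_norm ?addr_ge0 ?sqr_ge0//.
  rewrite -real_normK ?num_real//.
  by have := sqr_ge0 (`|err l i| - 1); have := normr_ge0 (err l i); nra.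
- apply: integrableD => //; last exact: ip.
  exact: finite_measure_integrable_cst.
Qed.

Let int_potential w : (\int[p]_l (potential x fam beta (obs w) l)%:E =
  ((\sum_i (xi i w ^+ 2 - 2 * xi i w * e1 i + e2 i)) / beta)%:E)%E.
Proof.
have E l : potential x fam beta (obs w) l =
  \sum_i (beta^-1 * xi i w ^+ 2 + (- (2 * beta^-1 * xi i w) * err l i
          + beta^-1 * err l i ^+ 2)).
  rewrite (potentialE n_gt0) mulr_suml; apply: eq_bigr => i _.
  rewrite mxE /err; ring.
under eq_integral do rewrite E -sumEFin.
have i1 i : p.-integrable setT (fun l => (- (2 * beta^-1 * xi i w) * err l i)%:E).
  by under eq_fun do rewrite EFinM; apply: integrableZl => //; exact: ie1.
have i2 i : p.-integrable setT (fun l => (beta^-1 * err l i ^+ 2)%:E).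
  by under eq_fun do rewrite EFinM; apply: integrableZl => //; exact: ip.
have i12 i : p.-integrable setT (fun l => (- (2 * beta^-1 * xi i w) * err l i
          + beta^-1 * err l i ^+ 2)%:E).
  by under eq_fun do rewrite EFinD; exact: integrableD.
have i0 i : p.-integrable setT (fun l => (beta^-1 * xi i w ^+ 2)%:E).
  exact: finite_measure_integrable_cst.
rewrite (integral_sum measurableT); last first.
  by move=> i; under eq_fun do rewrite EFinD; exact: integrableD.
rewrite mulr_suml -sumEFin; apply: eq_bigr => i _.
under eq_integral do rewrite EFinD.
rewrite integralD// integral_cst// [X in (_ * X)%E]probability_setT mule1.
under eq_integral do rewrite EFinD.
rewrite integralD//.
under eq_integral do rewrite EFinM.
rewrite integralZl//; last exact: ie1.
under [X in (_ + (_ + X))%E]eq_integral do rewrite EFinM.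
rewrite integralZl//; last exact: ip.
rewrite -(fineK (integrable_fin_num measurableT (ie1 i))).
rewrite -(fineK (integrable_fin_num measurableT (ip i))).
rewrite -/(\int[p]_l err l i) -/(\int[p]_l (err l i ^+ 2)) -!EFinM -!EFinD.
by congr EFin; rewrite /e1 /e2; ring.
Qed.

(** [beta] times the right-hand side of [posterior_gibbs] at the observations. It is integrable
    because the noise has finite second moment, and it serves as an envelope for [V] and, with
    [xi i w ^+ 2], for [M i w ^+ 2]. *)
Let T w := \sum_i (xi i w ^+ 2 - 2 * xi i w * e1 i + e2 i) + beta * K.

Let gibbs_obs w : \sum_i ((M i w - xi i w) ^+ 2 + V i w) <= T w.
Proof.
have := posterior_gibbs n_gt0 fam_meas beta_gt0 theta_int p (obs w).
rewrite int_potential KLK -EFinD lee_fin ler_pdivrMr// mulrDl divfK ?gt_eqF//.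
rewrite [K * _]mulrC => /(le_trans _); apply.
apply: ler_sum => i _; rewrite lerD2r /M mxE -subr_ge0.
by rewrite (_ : _ - _ = 0)//; ring.
Qed.

Let V_ge0 i w : 0 <= V i w. Proof. exact: posterior_var_ge0. Qed.

Let gibbs_obs1 i w : (M i w - xi i w) ^+ 2 + V i w <= T w.
Proof.
apply: le_trans (gibbs_obs w); rewrite (bigD1 i)//= lerDl.
by apply: sumr_ge0 => j _; rewrite addr_ge0 ?sqr_ge0.
Qed.

Let iT : P.-integrable setT (EFin \o T).
Proof.
rewrite /T /comp; under eq_fun do rewrite EFinD -sumEFin.
apply: integrableD => //; last exact: finite_measure_integrable_cst.
apply: integrable_sum => // i _.
under eq_fun do rewrite !EFinD EFinN.
apply: integrableD => //; last exact: finite_measure_integrable_cst.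
apply: integrableB => //.
rewrite (_ : (fun _ => _) = fun w => ((2 * e1 i)%:E * (xi i w)%:E)%E).
  exact: integrableZl.
by apply/funext => w; rewrite -EFinM; congr EFin; ring.
Qed.

Let mV i : measurable_fun setT (V i).
Proof. exact: measurable_posterior_var. Qed.

Let mM i : measurable_fun setT (M i).
Proof.
apply: measurable_funB => //.
exact: measurable_posterior_mean.
Qed.

Let mxi i : measurable_fun setT (xi i). Proof. exact: measurable_funPT. Qed.

Let iV i : P.-integrable setT (EFin \o V i).
Proof.
apply: le_integrable iT => //; first exact/measurable_EFinP.
move=> w _; rewrite /= lee_fin (ger0_norm (V_ge0 _ _)) (le_trans _ (ler_norm _))//.
by apply: le_trans (gibbs_obs1 i w); rewrite lerDr sqr_ge0.
Qed.

Let iM2 i : P.-integrable setT (EFin \o (fun w => M i w ^+ 2)).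
Proof.
apply: (@le_integrable _ _ _ P _ measurableT _
    (fun w => 2%:E * (T w)%:E + 2%:E * (xi i w ^+ 2)%:E)%E).
- by apply/measurable_EFinP; exact: measurable_funX.
- move=> w _; rewrite -!EFinM -EFinD /= lee_fin (ger0_norm (sqr_ge0 _)).
  rewrite (le_trans _ (ler_norm _))//.
  (* [2 * (M - xi) ^+ 2 + 2 * xi ^+ 2] exceeds [M ^+ 2] by exactly [(M - 2 * xi) ^+ 2]. *)
  have := gibbs_obs1 i w; have := V_ge0 i w.
  have := sqr_ge0 (M i w - 2 * xi i w).
  nra.
- by apply: integrableD => //; apply: integrableZl.
Qed.

Let ixiM i : P.-integrable setT (EFin \o (fun w => xi i w * (M i w - e1 i))).
Proof.
apply: (@le_integrable _ _ _ P _ measurableT _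
    (fun w => (xi i w ^+ 2)%:E + ((M i w ^+ 2)%:E + (e1 i ^+ 2)%:E))%E).
- apply/measurable_EFinP; apply: measurable_funM => //.
  exact: measurable_funB.
- move=> w _; rewrite -!EFinD /= lee_fin (ger0_norm (_ : 0 <= _ + (_ + _))); last first.
    by rewrite !addr_ge0 ?sqr_ge0.
  rewrite ler_norml; apply/andP; split.
    have := sqr_ge0 (M i w - e1 i + xi i w); have := sqr_ge0 (M i w + e1 i); have := sqr_ge0 (xi i w); nra.
  have := sqr_ge0 (M i w - e1 i - xi i w); have := sqr_ge0 (M i w + e1 i); have := sqr_ge0 (xi i w); nra.
- apply: integrableD => //; apply: integrableD => //; first exact: iM2.
  exact: finite_measure_integrable_cst.
Qed.

(** Twice [stein_coord] at [c = f (x i) + e1 i]: the cross term left by the noise is absorbed by the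
    posterior variance. *)
Let stein_bound i :
  (\int[P]_w (2 * (xi i w * (M i w - e1 i)) - V i w)%:E <= 0)%E.
Proof.
have E w : xi i w * (M i w - e1 i) = xi i w * (mean (obs w) i - (f (x i) + e1 i)).
  by rewrite /M; ring.
have i1 : P.-integrable setT (fun w => (xi i w * (mean (obs w) i - (f (x i) + e1 i)))%:E).
  by apply: eq_integrable (ixiM i) => // w _; rewrite /= E.
have i2 : P.-integrable setT (fun w => (2^-1 * var (obs w) i)%:E).
  by under eq_fun do rewrite EFinM; apply: integrableZl => //; exact: iV.
have := stein_coord i1 i2.
have -> : (\int[P]_w (2 * (xi i w * (M i w - e1 i)) - V i w)%:E =
  2%:E * (\int[P]_w (xi i w * (mean (obs w) i - (f (x i) + e1 i)))%:E -
    \int[P]_w (2^-1 * var (obs w) i)%:E))%E.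
  rewrite -integralB// -integralZl//; last exact: integrableB.
  apply: eq_integral => w _; rewrite -EFinB -EFinM E /V; congr EFin.
  by field.
move=> le12; rewrite mule_ge0_le0// sube_le0//.
Qed.

Lemma risk_bound_finite :
  (\int[P]_w (\sum_i M i w ^+ 2)%:E <= (\sum_i e2 i + beta * K)%:E)%E.
Proof.
pose S i w := 2 * (xi i w * (M i w - e1 i)) - V i w.
have iS i : P.-integrable setT (fun w => (S i w)%:E).
  rewrite /S; under eq_fun do rewrite EFinB EFinM.
  apply: integrableB => //; last exact: iV.
  by apply: integrableZl => //; exact: ixiM.
apply: (@le_trans _ _ (\int[P]_w (\sum_i (S i w)%:E + (\sum_i e2 i + beta * K)%:E))%E).
  have le w : \sum_i M i w ^+ 2 <= \sum_i S i w + (\sum_i e2 i + beta * K).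
    (* The squares of the noise cancel on the right, whose sum plus [beta * K] is the slack in
       [gibbs_obs], hence nonnegative. *)
    have E : \sum_i (S i w + e2 i - M i w ^+ 2) =
        \sum_i ((xi i w ^+ 2 - 2 * xi i w * e1 i + e2 i) -
                ((M i w - xi i w) ^+ 2 + V i w)).
      by apply: eq_bigr => i _; rewrite /S; ring.
    rewrite !sumrB [X in X - _ = _]big_split /= in E.
    by have := gibbs_obs w; rewrite /T; lra.
  apply: ge0_le_integral => //.
  - by move=> w _; rewrite lee_fin sumr_ge0// => i _; exact: sqr_ge0.
  - by apply/measurable_EFinP; apply: measurable_sum => i; exact: measurable_funX.
  - apply: emeasurable_funD => //; apply: emeasurable_sum => i.
    exact: measurable_int (iS i).
  - by move=> w _; rewrite sumEFin -EFinD lee_fin.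
rewrite integralD//; last 2 first.
- exact: integrable_sum.
- exact: finite_measure_integrable_cst.
rewrite integral_cst// [X in (_ + _ * X)%E]probability_setT mule1.
rewrite -[leRHS]add0e leeD2r//.
rewrite (integral_sum measurableT)//.
apply: sume_le0 => i _; exact: stein_bound.
Qed.

End finite_kl.

Theorem theorem1
  (R : realType) (X : Type) (n : nat) (n_gt0 : (0 < n)%N) (x : 'I_n -> X)
  (f : X -> R)
  (dO : measure_display) (Omega : measurableType dO) (P : probability Omega R)
  (xi : 'I_n -> {RV P >-> R})
  (xi_iid : iid xi) (xi_mean0 : forall i, ('E_P[xi i] = 0)%E)
  (dL : measure_display) (Lambda : measurableType dL)
  (fam : Lambda -> X -> R)
  (fam_meas : forall t : X, measurable_fun [set: Lambda] (fun l => fam l t))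
  (prior : probability Lambda R)
  (theta_int : forall (y : 'rV[R]_n) (b : R), 0 < b -> forall i : 'I_n,
    prior.-integrable [set: Lambda]
      (fun l => (theta x fam b prior y l * fam l (x i) ^+ 2)%:E))
  (sigma : R)
  (xi_var : ('E_P[fun w => (xi (Ordinal n_gt0) w ^+ 2)%R] = (sigma ^+ 2)%:E)%E)
  (g : R -> R) (g_ge0 : forall z, 0 <= g z)
  (g_meas : measurable_fun [set: R] g)
  (g_bounded : has_ubound (range g))
  (g_density : forall a a' : R,
    oriented (fun A => \int[lebesgue_measure]_(z in A)
                         (m_fun (xi (Ordinal n_gt0)) z)%:E)%E a a' =
    oriented (fun A => \int[distribution P (xi (Ordinal n_gt0))]_(z in A)
                         (g z)%:E)%E a a')
  (beta : R) (beta_gt0 : 0 < beta) (beta_ge : 4 * sup (range g) <= beta)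
  (p : probability Lambda R) :
  ('E_P[fun w => sqdist_fun x
          (aggregate x fam beta prior (observations x f xi w)) f]
   <= \int[p]_l (sqdist_fun x (fam l) f)%:E + (beta / n%:R)%:E * KL p prior)%E.
Proof.
have ti (y : 'rV[R]_n) := theta_int y beta beta_gt0.
have gle z : 4 * g z <= beta.
  apply: le_trans beta_ge; rewrite ler_wpM2l//.
  apply: ub_le_sup => //; exists z => //.
have gd a b : a <= b ->
  (\int[lebesgue_measure]_(z in `]a, b]) (m_fun (xi (Ordinal n_gt0)) z)%:E =
   \int[distribution P (xi (Ordinal n_gt0))]_(z in `]a, b]) (g z)%:E)%E.
  by move=> ab; have := g_density a b; rewrite /oriented ab.
pose err l := \sum_(i < n) (fam l (x i) - f (x i)) ^+ 2.
have merr : measurable_fun setT (fun l => (err l)%:E).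
  apply/measurable_EFinP; apply: measurable_sum => i.
  by apply: measurable_funX; exact: measurable_funB.
have err0 l : 0 <= err l by apply: sumr_ge0 => i _; exact: sqr_ge0.
have nV0 : 0 <= n%:R^-1 :> R by rewrite invr_ge0.
have n0 : n%:R != 0 :> R by rewrite pnatr_eq0 -lt0n.
have DE : (\int[p]_l (sqdist_fun x (fam l) f)%:E =
    n%:R^-1%:E * \int[p]_l (err l)%:E)%E.
  rewrite -ge0_integralZl//.
  by move=> l _; rewrite lee_fin.
have D0 : (0 <= \int[p]_l (sqdist_fun x (fam l) f)%:E)%E.
  by apply: integral_ge0 => l _; rewrite lee_fin mulr_ge0// err0.
have bn : (0 < (beta / n%:R)%:E)%E by rewrite lte_fin divr_gt0// ltr0n.
have K0 := KL_ge0 p prior.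
(* Both terms on the right are nonnegative and [beta / n%:R] is positive, so an infinite divergence
   or an infinite risk of [p] makes the bound trivial. *)
have [Koo|] := ltP (KL p prior) +oo%E; last first.
  rewrite leye_eq => /eqP ->; rewrite gt0_muley// addey ?leey//.
  by rewrite gt_eqF// (lt_le_trans _ D0)// ltNyr.
have [Doo|] := ltP (\int[p]_l (sqdist_fun x (fam l) f)%:E)%E +oo%E; last first.
  rewrite leye_eq => /eqP ->; rewrite addye ?leey//.
  by rewrite gt_eqF// (lt_le_trans (ltNyr 0))// mule_ge0// ltW.
have ierr : p.-integrable setT (fun l => (err l)%:E).
  apply/integrableP; split => //.
  under eq_integral do rewrite gee0_abs ?lee_fin//.
  rewrite -(@lte_pmul2l _ n%:R^-1%:E) ?lte_fin ?invr_gt0 ?ltr0n//.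
  by rewrite -DE gt0_muley ?lte_fin ?invr_gt0 ?ltr0n.
have ip i : p.-integrable setT (fun l => ((fam l (x i) - f (x i)) ^+ 2)%:E).
  apply: le_integrable ierr => //.
    by apply/measurable_EFinP; apply: measurable_funX; exact: measurable_funB.
  move=> l _; rewrite /= lee_fin !ger0_norm ?sqr_ge0// /err (bigD1 i)//= lerDl.
  by apply: sumr_ge0 => j _; exact: sqr_ge0.
have KE : KL p prior = (fine (KL p prior))%:E by rewrite fineK// ge0_fin_numE.
have mo i := measurable_obs x f xi i.
have RB := risk_bound_finite n_gt0 (integrable_noise xi_iid xi_var)
  (integrable_noise_sqr xi_iid xi_var) fam_meas beta_gt0 ti
  (fun i c => stein_coord xi_iid xi_mean0 fam_meas beta_gt0 ti xi_var
    g_ge0 g_meas gle gd (i := i) (c := c)) mo ip KE.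
pose S w := \sum_i (posterior_mean x fam prior beta (observations x f xi w) i - f (x i)) ^+ 2.
have mS : measurable_fun setT (fun w => (S w)%:E).
  apply/measurable_EFinP; apply: measurable_sum => i; apply: measurable_funX.
  apply: measurable_funB => //; exact: measurable_posterior_mean.
have -> : ('E_P[fun w => sqdist_fun x
    (aggregate x fam beta prior (observations x f xi w)) f] =
    n%:R^-1%:E * \int[P]_w (S w)%:E)%E.
  rewrite unlock -ge0_integralZl//.
  by move=> w _; rewrite lee_fin sumr_ge0// => i _; exact: sqr_ge0.
rewrite DE.
have -> : (\int[p]_l (err l)%:E =
    (\sum_i \int[p]_l ((fam l (x i) - f (x i)) ^+ 2))%:E)%E.
  under eq_integral do rewrite -sumEFin.
  rewrite (integral_sum measurableT)// -sumEFin; apply: eq_bigr => i _.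
  by rewrite /Rintegral fineK//; exact: integrable_fin_num.
have -> : ((beta / n%:R)%:E * KL p prior =
    n%:R^-1%:E * (beta * fine (KL p prior))%:E)%E.
  by rewrite KE -!EFinM; congr EFin; rewrite /=; ring.
(* All three terms now carry the factor [n%:R^-1]; what remains is [RB]. *)
rewrite -!EFinM -EFinD -mulrDr EFinM lee_wpmul2l// lee_fin.
Qed.
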